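(* Let $\mathbb{K}$ be an infinite field, let $d \ge 2$ and $n_1,\dots,n_d,m$ be positive integers, and let $F:\mathbb{K}^{n_1}\times\cdots\times\mathbb{K}^{n_d}\to\mathbb{K}^m$ be a multilinear map. For $0\le r\le \min\{n_d,m\}$ let \[ W_{r,F}(\mathbb{K}) \coloneqq \{(\mathsf{v}_1,\dots,\mathsf{v}_{d-1})\in \mathbb{K}^{n_1}\times\cdots\times\mathbb{K}^{n_{d-1}} : \operatorname{rank} F(\mathsf{v}_1,\dots,\mathsf{v}_{d-1},\cdot) = r\}, \] where $F(\mathsf{v}_1,\dots,\mathsf{v}_{d-1},\cdot)\in\operatorname{Hom}(\mathbb{K}^{n_d},\mathbb{K}^m)$ is the induced linear map. Then \[ \operatorname{codim} \overline{Z_F(\mathbb{K})} = \min_{0\le r\le \min\{n_d,m\}} \big\{ r + \operatorname{codim}\overline{W_{r,F}(\mathbb{K})}\big\}, \] where $\overline{Z_F(\mathbb{K})}$ has codimension taken in $\overline{\mathbb{K}}^{n_1+\cdots+n_d}$ and $\overline{W_{r,F}(\mathbb{K})}$ has codimension taken in $\overline{\mathbb{K}}^{n_1+\cdots+n_{d-1}}$.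
   Context: For an infinite field $\mathbb{K}$ and a subset $S\subseteq\mathbb{K}^n$, $\overline{S}\subseteq\overline{\mathbb{K}}^n$ denotes the set of common zeros in $\overline{\mathbb{K}}^n$ ($\overline{\mathbb{K}}$ an algebraic closure) of all polynomials in $\mathbb{K}[x_1,\dots,x_n]$ that vanish on $S$; it is a Zariski closed subset of $\overline{\mathbb{K}}^n$. Dimension is that of algebraic sets, $\operatorname{codim}\overline{S} = n-\dim\overline{S}$, with the convention $\operatorname{codim}\varnothing=+\infty$. For a multilinear map $F$, the multilinear variety is $Z_F(\mathbb{K}) \coloneqq \{\mathsf{v}\in\mathbb{K}^{n_1}\times\cdots\times\mathbb{K}^{n_d}: F(\mathsf{v})=0\}$. *)

(* Defs.v *)
From mathcomp Require Import all_boot all_algebra.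
From mathcomp Require Import mpoly.
From Stdlib Require Import ClassicalEpsilon.

Set Implicit Arguments.
Unset Strict Implicit.
Unset Printing Implicit Defensive.

Import GRing.Theory.
Local Open Scope ring_scope.

(* Points of R^T for a finite index type T are functions T -> R.       *)
(* Polynomials in the coordinates are {mpoly R[#|T|]}, variable k      *)
(* being the coordinate enum_val k.                                    *)

Definition evT (R : ringType) (T : finType) (x : T -> R) : 'I_#|T| -> R :=
  fun k => x (enum_val k).

Definition zclosure (K L : fieldType) (iota : {rmorphism K -> L})
  (T : finType) (A : (T -> K) -> Prop) : (T -> L) -> Prop :=
  fun y => forall p : {mpoly K[#|T|]},
    (forall x, A x -> p.@[evT x] = 0) -> (map_mpoly iota p).@[evT y] = 0.

Definition zclosed (L : fieldType) (T : finType) (V : (T -> L) -> Prop) : Prop :=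
  exists P : {mpoly L[#|T|]} -> Prop,
    forall y, V y <-> (forall p, P p -> p.@[evT y] = 0).

Definition subsetP' (X : Type) (A B : X -> Prop) : Prop := forall y, A y -> B y.

Definition zirred (L : fieldType) (T : finType) (V : (T -> L) -> Prop) : Prop :=
  [/\ zclosed V, exists y, V y &
      forall A B, zclosed A -> zclosed B ->
        subsetP' V (fun y => A y \/ B y) -> subsetP' V A \/ subsetP' V B].

Definition zchain (L : fieldType) (T : finType) (V : (T -> L) -> Prop) (k : nat)
  : Prop :=
  exists C : nat -> (T -> L) -> Prop,
    (forall i, (i <= k)%N -> zirred (C i) /\ subsetP' (C i) V) /\
    (forall i, (i < k)%N ->
       subsetP' (C i) (C i.+1) /\ exists y, C i.+1 y /\ ~ C i y).

Definition dim_is (L : fieldType) (T : finType) (V : (T -> L) -> Prop)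
  (d : option nat) : Prop :=
  match d with
  | None => forall y, ~ V y
  | Some k => zchain V k /\ (forall k', zchain V k' -> (k' <= k)%N)
  end.

Definition zdim (L : fieldType) (T : finType) (V : (T -> L) -> Prop) : option nat :=
  epsilon (inhabits None) (dim_is V).

(* Codimension in L^T; None stands for +infinity (codim of the empty set). *)
Definition zcodim (L : fieldType) (T : finType) (V : (T -> L) -> Prop)
  : option nat := omap (fun k => #|T| - k)%N (zdim V).

(* Arithmetic on nat extended by +infinity (= None). *)
Definition oadd (a b : option nat) : option nat :=
  match a, b with Some x, Some y => Some (x + y)%N | _, _ => None end.
Definition omin (a b : option nat) : option nat :=
  match a, b with
  | Some x, Some y => Some (minn x y)
  | None, _ => b
  | _, None => a
  end.

(* A point (v_1,...,v_d) is encoded as a function on the disjoint      *)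
(* union blk ns = {i : 'I_d & 'I_(ns i)} of the coordinate index sets. *)

Definition blk (d : nat) (ns : 'I_d -> nat) : finType := {i : 'I_d & 'I_(ns i)}.

Definition multilinear (K : fieldType) (d : nat) (ns : 'I_d -> nat) (m : nat)
  (F : (blk ns -> K) -> 'rV[K]_m) : Prop :=
  forall (i : 'I_d) (a : K) (x y z : blk ns -> K),
    (forall t : blk ns, tag t != i -> x t = z t /\ y t = z t) ->
    (forall t : blk ns, tag t = i -> z t = a * x t + y t) ->
    F z = a *: F x + F y.

Lemma lastd_proof (d : nat) : (0 < d)%N -> (d.-1 < d)%N.
Proof. by move=> h; rewrite ltn_predL. Qed.

Definition lastd (d : nat) (hd : (0 < d)%N) : 'I_d := Ordinal (lastd_proof hd).

Definition wblk (d : nat) (ns : 'I_d -> nat) (l : 'I_d) : finType :=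
  {t : blk ns | tag t != l}.

(* Given w = (v_1,...,v_{d-1}) and k, the point (v_1,...,v_{d-1}, e_k). *)
Definition ext_basis (K : fieldType) (d : nat) (ns : 'I_d -> nat) (l : 'I_d)
  (w : wblk ns l -> K) (k : 'I_(ns l)) : blk ns -> K :=
  fun t => match (insub t : option (wblk ns l)) with
           | Some s => w s
           | None => ((val (tagged t) == val k) : nat)%:R
           end.

Definition Fmat (K : fieldType) (d : nat) (ns : 'I_d -> nat) (m : nat)
  (F : (blk ns -> K) -> 'rV[K]_m) (l : 'I_d) (w : wblk ns l -> K)
  : 'M[K]_(ns l, m) :=
  \matrix_(k < ns l, j < m) F (ext_basis w k) 0 j.

Definition ZF (K : fieldType) (d : nat) (ns : 'I_d -> nat) (m : nat)
  (F : (blk ns -> K) -> 'rV[K]_m) : (blk ns -> K) -> Prop :=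
  fun x => F x = 0.

Definition WrF (K : fieldType) (d : nat) (ns : 'I_d -> nat) (m : nat)
  (F : (blk ns -> K) -> 'rV[K]_m) (l : 'I_d) (r : nat)
  : (wblk ns l -> K) -> Prop :=
  fun w => \rank (Fmat F w) = r.

Arguments WrF {K d ns m} F l r _.
Arguments Fmat {K d ns m} F l w.
Arguments ext_basis {K d ns} l w k _.

(* Main.v *)
(* For a set S of K-points let tr(S) be the largest number of coordinates satisfying
   no nonzero polynomial relation over K on S.  The proof has three ingredients.

   1. dim = tr for Zariski closed sets over an algebraically closed field.  Along a
   strict inclusion of irreducible sets tr increases.  Conversely, if c_1, .., c_k
   are independent on V, then the image of V in L^k contains a nonempty principal
   open set (quantifier elimination), so that k-1 coordinates remain independent on
   a suitable slice c_k = a; a minimal closed subset on which they are independent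
   is irreducible, which produces a chain by induction.

   2. tr does not change when passing from S to its closure over L, because the rank
   of a matrix does not depend on the field.

   3. tr is monotone under algebraic dependence: if the functions g_i become
   polynomials in x after multiplication by a nonvanishing polynomial in x, then
   tr(g) <= tr(x).  This is a count of monomials: polynomials of degree <= D in x
   span a space of dimension O(D^tr(x)) of functions on S.  Solving v A(w) = 0 with
   Cramer's rule on the piece of Z_F where A(w) has rank r and a given r-minor is
   invertible, this gives tr(Z_F) = max_r (tr(W_r) + n_d - r). *)

Require Import Defs.
From mathcomp Require Import all_boot all_algebra.
From mathcomp Require Import mpoly.
From mathcomp Require Import order closed_field zify.
From Stdlib Require Import Classical ClassicalEpsilon.

Set Implicit Arguments.
Unset Strict Implicit.
Unset Printing Implicit Defensive.

Import GRing.Theory.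
Local Open Scope ring_scope.
Local Notation widen := (widen_ord (leqnSn _)).

(** * Algebraic independence on a set *)

(** On an empty [S] this fails even for [k = 0], as the constant 1 vanishes there; independence thus
    also records that [S] is nonempty. *)
Definition algind (K : fieldType) (X : Type) (S : X -> Prop) (k : nat)
  (g : X -> 'I_k -> K) : Prop :=
  forall p : {mpoly K[k]}, (forall y, S y -> p.@[g y] = 0) -> p = 0.

Lemma not_algind (K : fieldType) (X : Type) (S : X -> Prop) (k : nat)
  (g : X -> 'I_k -> K) :
  ~ algind S g -> exists2 p : {mpoly K[k]}, p != 0 & forall y, S y -> p.@[g y] = 0.
Proof.
move=> h; apply: NNPP => h'; apply: h => p p0; apply/eqP/negPn/negP => pn0.
by apply: h'; exists p.
Qed.

Lemma algind_sub (K : fieldType) (X : Type) (S S' : X -> Prop) (k : nat)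
  (g : X -> 'I_k -> K) : (forall y, S y -> S' y) -> algind S g -> algind S' g.
Proof. by move=> sSS' h p p0; apply: h => y /sSS' /p0. Qed.

(** The product of relations on the pieces is a relation on the union, nonzero because polynomials
    form a domain. This permits splitting by rank, by minor or by a closed cover. *)
Lemma algind_union (K : fieldType) (X : Type) (I : finType) (S : I -> X -> Prop)
    (k : nat) (g : X -> 'I_k -> K) :
  algind (fun y => exists i, S i y) g -> exists i, algind (S i) g.
Proof.
move=> h; apply: NNPP => nex.
have /fin_all_exists2[p pn0 pv] i : exists2 p : {mpoly K[k]}, p != 0 &
    forall y, S i y -> p.@[g y] = 0.
  by apply: not_algind => hi; apply: nex; exists i.
have : \prod_i p i = 0.
  apply: h => y [i Siy]; rewrite rmorph_prod /=.
  by rewrite (bigD1 i) //= pv // mul0r.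
by apply/eqP/prodf_neq0 => i _; apply: pn0.
Qed.

Lemma algind_inj (K : fieldType) (X : Type) (S : X -> Prop) (n k : nat)
    (x : X -> 'I_n -> K) (c : 'I_k -> 'I_n) :
  algind S (fun y i => x y (c i)) -> injective c.
Proof.
move=> h i j cij; apply/eqP.
have /eqP : 'X_i - 'X_j = 0 :> {mpoly K[k]}.
  by apply: h => y _; rewrite mevalB !mevalXU cij subrr.
rewrite subr_eq0 => /eqP /(congr1 (mcoeff U_(i))).
rewrite !mcoeffXU eqxx eq_sym; case: eqP => // _ /eqP.
by rewrite oner_eq0.
Qed.

Lemma widen_lift n (j : 'I_n) : widen j = lift ord_max j.
Proof. exact/val_inj/esym/lift_max. Qed.

(** * Polynomials as univariate polynomials in the last variable *)

Section Muni.
Variables (n : nat) (R : fieldType).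
Implicit Types p : {mpoly R[n.+1]}.

Lemma mcoeff_muni p i (m : 'X_{1..n}) :
  ((muni p)`_i)@_m =
  p@_[multinom (if unlift ord_max j is Some j' then m j' else i) | j < n.+1].
Proof.
set M := [multinom _ | j < _].
have ME (m' : 'X_{1..n.+1}) :
    (m' == M) = ([multinom m' (widen j) | j < n] == m) && (m' ord_max == i).
  apply/eqP/andP => [->|[/eqP /mnmP e1 /eqP e2]].
    split; last by rewrite mnmE unlift_none.
    apply/eqP/mnmP => j; rewrite mnmE mnmE.
    by rewrite widen_lift liftK.
  apply/mnmP => j; rewrite mnmE; case: unliftP => [j' ->|-> //].
  rewrite -e1 mnmE; by rewrite widen_lift.
rewrite muniE coef_sum raddf_sum /= [in RHS](mpolyE p) raddf_sum /=.
apply: eq_bigr => m' _.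
rewrite coefZ coefXn [RHS]mcoeffZ mcoeffX ME eq_sym.
case: eqP => _; rewrite ?andbF ?mulr0 ?mcoeff0 // andbT mulr1.
by rewrite mcoeffZ mcoeffX.
Qed.

Lemma muni_inj p : muni p = 0 -> p = 0.
Proof.
move=> p0; apply/mpolyP => m; rewrite mcoeff0.
have := mcoeff_muni p (m ord_max) [multinom m (widen j) | j < n].
rewrite p0 coef0 mcoeff0 => ->; congr (p@__); apply/mnmP => j.
rewrite mnmE; case: unliftP => [j' ->|->] //.
by rewrite mnmE widen_lift.
Qed.

Lemma meval_muni p (v : 'I_n.+1 -> R) :
  p.@[v] = (map_poly (meval (fun j => v (widen j))) (muni p)).[v ord_max].
Proof.
rewrite mevalE muniE raddf_sum /= horner_sum; apply: eq_bigr => m _.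
rewrite map_polyZ /= mevalZ mevalX map_polyXn hornerZ hornerXn -mulrA.
congr (_ * _); rewrite big_ord_recr /=; congr (_ * _).
by apply: eq_bigr => i _; rewrite mnmE.
Qed.

End Muni.

(** * Independence over an infinite field *)

Section Infinite.
Variable K : fieldType.
Hypothesis K_infinite : forall s : seq K, exists x : K, x \notin s.

Lemma infinite_seq N : exists s : seq K, uniq s /\ size s = N.
Proof.
elim: N => [|N [s [us <-]]]; first by exists [::].
by have [x xs] := K_infinite s; exists (x :: s); rewrite /= xs us.
Qed.

Lemma infinite_poly_eq0 (p : {poly K}) : (forall t, p.[t] = 0) -> p = 0.
Proof.
move=> p0; have [s [us ss]] := infinite_seq (size p).
by apply: (roots_geq_poly_eq0 _ us); rewrite ?ss //; apply/allP => t _; apply/eqP.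
Qed.

(** A relation among the [g], read as a univariate polynomial in the last variable, vanishes at
    every [t] over each point of [S0]. Its coefficients are then relations among the [g0]. *)
Lemma algind_fiber (X Y : Type) (S0 : Y -> Prop) (S : X -> Prop) (k : nat)
    (g0 : Y -> 'I_k -> K) (g : X -> 'I_k.+1 -> K) :
  (forall y t, S0 y -> exists x, [/\ S x,
     forall i, g x (widen i) = g0 y i & g x ord_max = t]) ->
  algind S0 g0 -> algind S g.
Proof.
move=> fib ind p p0; apply: muni_inj; apply/polyP => i; rewrite coef0.
apply: ind => y Sy.
have : map_poly (meval (g0 y)) (muni p) = 0.
  apply: infinite_poly_eq0 => t; have [x [Sx gx gt]] := fib y t Sy.
  have := p0 x Sx; rewrite meval_muni gt => <-.
  congr (_.[_]); apply: eq_map_poly => q; apply: meval_eq => j.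
  by rewrite gx.
by move=> /(congr1 (fun q : {poly K} => q`_i)); rewrite coef_map coef0.
Qed.

Lemma algind_id n : algind (fun _ : 'I_n -> K => True) (fun y => y).
Proof.
elim: n => [|n IHn].
  move=> p p0; rewrite (nvar0_mpolyC p); have := p0 (fun=> 0) I.
  by rewrite [in X in X -> _](nvar0_mpolyC p) mevalC => ->; rewrite mpolyC0.
apply: algind_fiber IHn => y t _.
exists (fun j => if unlift ord_max j is Some j' then y j' else t); split => //.
  by move=> i; rewrite widen_lift liftK.
by rewrite unlift_none.
Qed.

Lemma mpoly_nonzero_point n (p : {mpoly K[n]}) : p != 0 -> exists v, p.@[v] != 0.
Proof.
move=> pn0; apply: NNPP => h; case/eqP: pn0; apply: algind_id => y _.
by apply/eqP/negPn/negP => py; apply: h; exists y.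
Qed.

End Infinite.

(** * Counting monomials *)

(** The exponent vector of ['X_[m]] after substituting ['X_(c i)] for ['X_i]; exponents add up where
    [c] is not injective. *)
Definition mrename k n (c : 'I_k -> 'I_n) (m : 'X_{1..k}) : 'X_{1..n} :=
  (\sum_i U_(c i) *+ m i)%MM.

Lemma mrenameE k n (c : 'I_k -> 'I_n) m j :
  mrename c m j = (\sum_(i | c i == j) m i)%N.
Proof.
rewrite mnm_sumE [RHS]big_mkcond; apply: eq_bigr => i _.
by rewrite mulmnE mnm1E; case: eqP; rewrite ?mul1n ?mul0n.
Qed.

Lemma mrename_inj k n (c : 'I_k -> 'I_n) : injective c -> injective (mrename c).
Proof.
move=> ic m m' e; apply/mnmP => i.
have := congr1 (fun u : 'X_{1..n} => u (c i)) e; rewrite !mrenameE.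
by rewrite !(eq_bigl (pred1 i)) ?big_pred1_eq // => j /=; rewrite (inj_eq ic).
Qed.

Definition rename (R : fieldType) k n (c : 'I_k -> 'I_n) (p : {mpoly R[k]}) :
  {mpoly R[n]} := p \mPo [tuple 'X_(c i) | i < k].

Lemma meval_rename (R : fieldType) k n (c : 'I_k -> 'I_n) (p : {mpoly R[k]}) v :
  (rename c p).@[v] = p.@[fun i => v (c i)].
Proof.
rewrite /rename comp_mpoly_meval; apply: meval_eq => i.
by rewrite tnth_mktuple mevalXU.
Qed.

Lemma renameE (R : fieldType) k n (c : 'I_k -> 'I_n) (p : {mpoly R[k]}) :
  rename c p = \sum_(m <- msupp p) p@_m *: 'X_[mrename c m].
Proof.
rewrite /rename comp_mpolyEX; apply: eq_bigr => m _; congr (_ *: _).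
rewrite comp_mpolyX -mprodXnE; apply: eq_bigr => i _.
by rewrite tnth_mktuple.
Qed.

Lemma rename_eq0 (R : fieldType) k n (c : 'I_k -> 'I_n) (p : {mpoly R[k]}) :
  injective c -> rename c p = 0 -> p = 0.
Proof.
move=> ic p0; apply/mpolyP => m; rewrite mcoeff0.
have := congr1 (mcoeff (mrename c m)) p0; rewrite mcoeff0 => <-.
rewrite renameE [in LHS](mpolyE p) !raddf_sum /=; apply: eq_bigr => m' _.
by rewrite !mcoeffZ !mcoeffX (inj_eq (mrename_inj ic)).
Qed.

Lemma msupp_rename (R : fieldType) k n (c : 'I_k -> 'I_n) (p : {mpoly R[k]}) m j :
  m \in msupp (rename c p) -> (m j != 0)%N -> exists i, c i = j.
Proof.
rewrite renameE => /msupp_sum_le/flattenP[_ /mapP[m' _ ->]].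
move=> /msuppZ_le /mem_msuppXP <-; rewrite mrenameE => h.
apply: NNPP => nc; case/negP: h; rewrite big_pred0 // => i.
by apply/negbTE/eqP => e; apply: nc; exists i.
Qed.

Lemma msizeM_leS (R : fieldType) n (p q : {mpoly R[n]}) a b :
  (msize p <= a.+1 -> msize q <= b.+1 -> msize (p * q) <= (a + b).+1)%N.
Proof.
have [->|pn0] := eqVneq p 0; first by rewrite mul0r msize0.
have [->|qn0] := eqVneq q 0; first by rewrite mulr0 msize0.
move=> ha hb; rewrite msizeM //.
by have := leq_add ha hb; rewrite addSn addnS; case: (_ + _)%N.
Qed.

Lemma msizeX_leS (R : fieldType) n (p : {mpoly R[n]}) a u :
  (msize p <= a.+1 -> msize (p ^+ u) <= (u * a).+1)%N.
Proof.
move=> ha; elim: u => [|u IH]; first by rewrite expr0 msize1.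
by rewrite exprS mulSn; apply: msizeM_leS.
Qed.

Lemma msize_prod_leS (R : fieldType) n (I : Type) (s : seq I)
    (p : I -> {mpoly R[n]}) a :
  (forall i, msize (p i) <= a.+1)%N ->
  (msize (\prod_(i <- s) p i)%R <= (size s * a).+1)%N.
Proof.
move=> ha; elim: s => [|i s IH]; first by rewrite big_nil msize1.
by rewrite big_cons /= mulSn; apply: msizeM_leS.
Qed.

Definition spanned (K : fieldType) (X : Type) (S : X -> Prop) (E : finType)
  (b : E -> X -> K) (phi : X -> K) : Prop :=
  exists a : E -> K, forall y, S y -> phi y = \sum_e a e * b e y.

Section Counting.
Variables (K : fieldType) (X : Type) (S : X -> Prop) (n : nat) (x : X -> 'I_n -> K).

Lemma spanned_base (E : finType) (b : E -> X -> K) e : spanned S b (b e).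
Proof.
exists (fun e' => (e' == e)%:R) => y _.
by rewrite (bigD1 e) //= eqxx mul1r big1 ?addr0 // => i /negbTE->; rewrite mul0r.
Qed.

Lemma spanned_sum (E : finType) (b : E -> X -> K) (I : eqType) (s : seq I)
    (f : I -> K) (phi : I -> X -> K) psi :
  (forall i, i \in s -> f i != 0 -> spanned S b (phi i)) ->
  (forall y, S y -> psi y = \sum_(i <- s) f i * phi i y) -> spanned S b psi.
Proof.
elim: s psi => [|i s IH] psi h hpsi.
  exists (fun=> 0) => y Sy; rewrite hpsi // big_nil big1 // => e _.
  by rewrite mul0r.
have [a ha] : spanned S b (fun y => \sum_(i <- s) f i * phi i y).
  by apply: IH => // j js; apply: h; rewrite inE js orbT.
have [f0|fn0] := eqVneq (f i) 0.
  by exists a => y Sy; rewrite hpsi // big_cons f0 mul0r add0r ha.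
have [a' ha'] := h i (mem_head _ _) fn0.
exists (fun e => f i * a' e + a e) => y Sy; rewrite hpsi // big_cons ha // ha' //.
by rewrite mulr_sumr -big_split; apply: eq_bigr => e _; rewrite mulrDl mulrA.
Qed.

Variable k : nat.

(* u.1 is the list of exponents truncated at e, and u.2 lists the at most k exponents
   that are at least e. *)
Definition decode e D (u : {ffun 'I_n -> 'I_e.+1} * k.-tuple 'I_D.+1) : 'X_{1..n} :=
  [multinom (if (u.1 j < e)%N then u.1 j : nat else
     nth ord0 u.2 (index j (enum [set i | (u.1 i == e :> nat)])) : nat) | j < n].

(** Monomials of degree at most [D] with at most [k] exponents that are at least [e] thus number at
    most (e+1)^n (D+1)^k, which has order k in D. *)
Lemma decode_surj e D (m : 'X_{1..n}) :
  (mdeg m <= D)%N -> (#|[set j | e <= m j]| <= k)%N ->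
  exists u, decode (e := e) (D := D) u = m.
Proof.
move=> mD; set B := [set j | _] => Bk.
have mleD j : (m j <= D)%N.
  by apply: leq_trans mD; rewrite mdegE (bigD1 j) //= leq_addr.
pose f : {ffun 'I_n -> 'I_e.+1} := [ffun j => inord (minn (m j) e)].
have fE j : f j = minn (m j) e :> nat by rewrite ffunE inordK // ltnS geq_minr.
have BE : [set i | (f i == e :> nat)] = B.
  apply/setP => j; rewrite !inE fE; apply/eqP/idP => [<-|/minn_idPr //].
  exact: geq_minl.
pose h : k.-tuple 'I_D.+1 :=
  [tuple inord (nth 0 [seq m j | j <- enum B] i)%N | i < k].
have hE i (ik : (i < k)%N) : nth ord0 h i = tnth h (Ordinal ik) by rewrite (tnth_nth ord0).
exists (f, h); apply/mnmP => j; rewrite mnmE -[(f, h).1]/f -[(f, h).2]/h BE fE.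
case: ltnP => [|le]; first by rewrite gtn_min ltnn orbF => /ltnW/minn_idPl.
have jB : j \in B by rewrite inE; apply: leq_trans le (geq_minl _ _).
have idx : (index j (enum B) < #|B|)%N by rewrite cardE index_mem mem_enum.
have idk := leq_trans idx Bk.
rewrite hE tnth_mktuple /=.
rewrite (nth_map j) -?cardE // nth_index ?mem_enum // inordK // ltnS.
exact: mleD.
Qed.

Hypothesis dep : forall c : 'I_k.+1 -> 'I_n, ~ algind S (fun y i => x y (c i)).

(* A relation among k+1 of the coordinates rewrites every multiple of its leading
   monomial in terms of smaller ones; what cannot be rewritten has at most k large
   exponents. *)
Lemma monomials_spanned : exists e : nat, forall D (m : 'X_{1..n}),
  (mdeg m <= D)%N ->
  spanned S (fun u y => 'X_[decode (e := e) (D := D) u].@[x y]) (fun y => 'X_[m].@[x y]).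
Proof.
have /fin_all_exists[P HP] (c : {ffun 'I_k.+1 -> 'I_n}) :
  exists P : {mpoly K[n]}, injective c -> [/\ P != 0,
    forall y, S y -> P.@[x y] = 0 &
    forall m j, m \in msupp P -> (m j != 0)%N -> exists i, c i = j].
  have [p pn0 pv] := not_algind (@dep c).
  exists (rename c p) => ic; split.
  - by apply: contraNneq pn0 => /rename_eq0 -> //.
  - by move=> y Sy; rewrite meval_rename pv.
  - by move=> m j; apply: msupp_rename.
(* [e] bounds every exponent of every leading monomial, so such a monomial divides [m] as soon as
   its variables all have exponent at least [e] in [m]. *)
exists (\max_c mdeg (mlead (P c)))%N => D.
set e := (\max_c _)%N.
elim/(well_founded_induction (@ltom_wf n)) => m IH mD.
have [Bk|Bk] := leqP #|[set j | (e <= m j)%N]| k.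
  have [u <-] := decode_surj mD Bk; exact: spanned_base.
pose c : {ffun 'I_k.+1 -> 'I_n} := [ffun i => enum_val (widen_ord Bk i)].
have ic : injective c.
  move=> i j; rewrite !ffunE => /enum_val_inj /(congr1 val) /= e'.
  exact: val_inj.
have [Pn0 Pv Ps] := HP c ic.
have lem : (mlead (P c) <= m)%MM.
  apply/mnm_lepP => j; case: (eqVneq (mlead (P c) j) 0%N) => [-> //|nz].
  have [i ci] := Ps _ j (mlead_supp Pn0) nz.
  have : j \in [set j | (e <= m j)%N] by rewrite -ci ffunE enum_valP.
  rewrite inE; apply: leq_trans; apply: leq_trans (leq_bigmax c).
  by rewrite mdegE (bigD1 j) //= leq_addr.
pose s := [seq m' <- msupp (P c) | m' != mlead (P c)].
pose m0 := (m - mlead (P c))%MM.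
apply: (@spanned_sum _ _ _ s (fun m' => - (P c)@_m' / (P c)@_(mlead (P c)))
   (fun m' y => 'X_[(m0 + m')%MM].@[x y])).
  move=> m'; rewrite mem_filter => /andP[ne ins] _.
  (* The monomial order is compatible with products and with the degree, so the degree bound [D]
     persists. *)
  have lt : ((m0 + m')%MM < m)%O.
    rewrite -[X in (_ < X)%O](submK lem) ltmc_add2r.
    by rewrite Order.POrderTheory.lt_neqAle ne msupp_le_mlead.
  apply: IH => //; apply: leq_trans mD.
  by apply: lemc_mdeg; apply: Order.POrderTheory.ltW.
move=> y Sy.
have lc0 : (P c)@_(mlead (P c)) != 0 by rewrite mleadc_eq0.
have := Pv y Sy; rewrite {1}(mpolyE (P c)) raddf_sum /=.
rewrite (bigD1_seq (mlead (P c))) ?mlead_supp ?msupp_uniq //= mevalZ.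
move/eqP; rewrite addr_eq0 => /eqP E.
rewrite -[in LHS](submK lem) mpolyXD mevalM -/m0.
have -> : ('X_[mlead (P c)]).@[x y] =
  ((P c)@_(mlead (P c)))^-1 * ((P c)@_(mlead (P c)) * ('X_[mlead (P c)]).@[x y]).
  by rewrite mulKf.
rewrite E mulrN mulr_sumr mulrN mulr_sumr -sumrN /s big_filter.
apply: eq_bigr => m' _; rewrite mevalZ mpolyXD mevalM.
by rewrite !mulNr; congr (- _); rewrite !mulrA; congr (_ * _);
  rewrite [LHS]mulrC [X in _ * X]mulrC mulrA.
Qed.

End Counting.

Lemma lin_dep (K : fieldType) (U E : finType) (a : U -> E -> K) :
  (#|E| < #|U|)%N -> exists2 r : U -> K, (exists u, r u != 0) &
    forall e, \sum_u r u * a u e = 0.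
Proof.
move=> lt.
pose A : 'M[K]_(#|U|, #|E|) := \matrix_(i, j) a (enum_val i) (enum_val j).
have kn0 : nz_row (kermx A) != 0.
  rewrite nz_row_eq0 -mxrank_eq0 mxrank_ker -lt0n subn_gt0.
  exact: leq_ltn_trans (rank_leq_col A) lt.
exists (fun u => nz_row (kermx A) 0 (enum_rank u)).
  have /rV0Pn[i hi] := kn0; exists (enum_val i); rewrite enum_valK.
  exact: hi.
move=> e; have /sub_kermxP/matrixP/(_ 0 (enum_rank e)) := nz_row_sub (kermx A).
rewrite !mxE => E0; rewrite -[RHS]E0 (reindex (@enum_val U predT)); last first.
  exact: onW_bij (enum_val_bij _).
by apply: eq_bigr => i _; rewrite mxE enum_valK enum_rankK.
Qed.

(** If no [k] of the functions [x] are independent, polynomials of degree O(N) in [x] span only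
    O(N^(k-1)) functions on [S]. There are (N+1)^k monomials in [g] with exponents at most N, all
    polynomial in [x] after multiplication by one power of [D]. For large N they are linearly
    dependent, which is a relation among the [g]. *)
Lemma algind_transfer (K : fieldType) (X : Type) (S : X -> Prop) (n : nat)
    (x : X -> 'I_n -> K) (k : nat) (g : X -> 'I_k -> K)
    (D : {mpoly K[n]}) (P : 'I_k -> {mpoly K[n]}) :
  (forall y, S y -> D.@[x y] != 0) ->
  (forall y i, S y -> D.@[x y] * g y i = (P i).@[x y]) ->
  algind S g -> exists c : 'I_k -> 'I_n, algind S (fun y i => x y (c i)).
Proof.
case: k g P => [|k] g P D0 DP gind.
  exists (fun i : 'I_0 => match i with Ordinal _ h => match notF h with end end).
  move=> p p0; apply: gind => y Sy; rewrite -[RHS](p0 y Sy).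
  by apply: meval_eq => -[].
apply: NNPP => nex.
have dep (c : 'I_k.+1 -> 'I_n) : ~ algind S (fun y i => x y (c i)).
  by move=> h; apply: nex; exists c.
have [e He] := monomials_spanned dep.
pose d := (msize D + \max_i msize (P i))%N.
have Dd : (msize D <= d.+1)%N by rewrite leqW // leq_addr.
have Pd i : (msize (P i) <= d.+1)%N.
  by rewrite leqW // (leq_trans _ (leq_addl _ _)) // (leq_bigmax i).
(* Since M+1 <= ((k+1)d+1)(N+1), this choice gives |E| <= N (N+1)^k < (N+1)^(k+1) = |U|. *)
pose N := (e.+1 ^ n * (k.+1 * d).+1 ^ k)%N.
pose M := (k.+1 * (N * d))%N.
pose U : finType := {ffun 'I_k.+1 -> 'I_N.+1}.
pose E : finType := ({ffun 'I_n -> 'I_e.+1} * k.-tuple 'I_M.+1)%type.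
pose b (u : E) y := 'X_[decode u].@[x y].
(* On [S], [Q u] is the monomial in [g] with exponents [u] times D^((k+1)N); this factor is the same
   for all [u] and can be cancelled at the end. *)
pose Q (u : U) := \prod_i (P i ^+ u i * D ^+ (N - u i)).
have Qd u : (msize (Q u) <= M.+1)%N.
  have := @msize_prod_leS K n _ (enum 'I_k.+1)
    (fun i => P i ^+ u i * D ^+ (N - u i)) (N * d).
  rewrite size_enum_ord big_enum /=; apply => i.
  have -> : (N * d = u i * d + (N - u i) * d)%N.
    by rewrite -mulnDl subnKC // -ltnS.
  by apply: msizeM_leS; apply: msizeX_leS.
have /fin_all_exists[a Ha] (u : U) : spanned S b (fun y => (Q u).@[x y]).
  apply: (@spanned_sum _ _ _ _ _ _ (msupp (Q u)) (fun m => (Q u)@_m)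
    (fun m y => 'X_[m].@[x y])).
    move=> m ms _; apply: He; rewrite -ltnS.
    exact: leq_trans (msize_mdeg_lt ms) (Qd u).
  move=> y _; rewrite {1}(mpolyE (Q u)) raddf_sum /=.
  by apply: eq_bigr => m _; rewrite mevalZ.
have ltEU : (#|E| < #|U|)%N.
  rewrite card_prod card_tuple !card_ffun !card_ord.
  have h : (M.+1 <= (k.+1 * d).+1 * N.+1)%N.
    rewrite /M mulnCA [X in (_ <= X)%N]mulSn addSn ltnS.
    by apply: leq_trans (leq_addl _ _); rewrite mulnC leq_mul2l leqnSn orbT.
  apply: (@leq_ltn_trans (N * N.+1 ^ k)%N); last first.
    by rewrite [X in (_ < X)%N]expnS ltn_pmul2r ?expn_gt0.
  have le_expl a1 a2 : (a1 <= a2 -> a1 ^ k <= a2 ^ k)%N.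
    by case: (k) => // k' le12; rewrite leq_exp2r.
  by rewrite /N -mulnA leq_mul2l -expnMn le_expl ?orbT.
have [r [u0 ru0] rE] := lin_dep a ltEU.
pose mu (u : U) : 'X_{1..k.+1} := [multinom u i : nat | i < k.+1].
have mu_inj : injective mu.
  move=> u u' e'; apply/ffunP => i; apply: val_inj.
  by have := congr1 (fun m : 'X_{1..k.+1} => m i) e'; rewrite !mnmE.
pose R := \sum_u r u *: 'X_[mu u] : {mpoly K[k.+1]}.
have /eqP[] : R@_(mu u0) != 0.
  rewrite raddf_sum /= (bigD1 u0) //= big1 ?addr0.
    by rewrite mcoeffZ mcoeffX eqxx mulr1.
  by move=> u ne; rewrite mcoeffZ mcoeffX (inj_eq mu_inj) (negbTE ne) mulr0.
suff -> : R = 0 by rewrite mcoeff0.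
apply: gind => y Sy.
have := D0 y Sy => /(expf_neq0 (k.+1 * N)) /mulfI; apply; rewrite mulr0.
transitivity (\sum_u r u * (Q u).@[x y]).
  rewrite raddf_sum mulr_sumr; apply: eq_bigr => u _ /=.
  rewrite mevalZ mulrCA; congr (_ * _).
  rewrite /Q rmorph_prod /= mevalX mulnC exprM.
  have -> : D.@[x y] ^+ N ^+ k.+1 = \prod_(i < k.+1) D.@[x y] ^+ N.
    by rewrite prodr_const card_ord.
  rewrite -big_split; apply: eq_bigr => i _ /=.
  rewrite mevalM !rmorphXn /= mnmE -DP // exprMn mulrAC -exprD subnKC //.
  by rewrite -ltnS.
transitivity (\sum_e' (\sum_u r u * a u e') * b e' y).
  rewrite (eq_bigr (fun e' => \sum_u r u * a u e' * b e' y)); last first.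
    by move=> e' _; rewrite mulr_suml.
  rewrite exchange_big; apply: eq_bigr => u _ /=.
  by rewrite Ha // mulr_sumr; apply: eq_bigr => e' _; rewrite mulrA.
by rewrite big1 // => e' _; rewrite rE mul0r.
Qed.

(** * Polynomial functions and irreducible closed sets *)

(** The inequality tr(V) >= k; working with such inequalities avoids naming the maximum. *)
Definition trge (K : fieldType) (T : finType) (V : (T -> K) -> Prop) (k : nat) :
  Prop := exists c : 'I_k -> T, algind V (fun y i => y (c i)).

(** A predicate on functions, so that polynomiality follows from closure properties rather than from
    explicit polynomials in enumerated variables. *)
Definition polyfun (K : fieldType) (T : finType) (phi : (T -> K) -> K) : Prop :=
  exists P : {mpoly K[#|T|]}, forall y, phi y = P.@[evT y].

Section Polyfun.
Variables (K : fieldType) (T : finType).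
Implicit Types phi psi : (T -> K) -> K.

Lemma polyfun_ext phi psi : (forall y, phi y = psi y) -> polyfun psi -> polyfun phi.
Proof. by move=> e [P HP]; exists P => y; rewrite e. Qed.

Lemma polyfun_coord t : polyfun (fun y : T -> K => y t).
Proof. by exists 'X_(enum_rank t) => y; rewrite mevalXU /evT enum_rankK. Qed.

Lemma polyfun_const (a : K) : polyfun (fun _ : T -> K => a).
Proof. by exists a%:MP => y; rewrite mevalC. Qed.

Lemma polyfunD phi psi : polyfun phi -> polyfun psi -> polyfun (fun y => phi y + psi y).
Proof. by move=> [P HP] [Q HQ]; exists (P + Q) => y; rewrite HP HQ mevalD. Qed.

Lemma polyfunM phi psi : polyfun phi -> polyfun psi -> polyfun (fun y => phi y * psi y).
Proof. by move=> [P HP] [Q HQ]; exists (P * Q) => y; rewrite HP HQ mevalM. Qed.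

Lemma polyfun_sum (I : Type) (s : seq I) (phi : I -> (T -> K) -> K) :
  (forall i, polyfun (phi i)) -> polyfun (fun y => \sum_(i <- s) phi i y).
Proof.
move=> h; elim: s => [|i s IH].
  by apply: polyfun_ext (polyfun_const 0) => y; rewrite big_nil.
by apply: polyfun_ext (polyfunD (h i) IH) => y; rewrite big_cons.
Qed.

Lemma polyfun_prod (I : Type) (s : seq I) (phi : I -> (T -> K) -> K) :
  (forall i, polyfun (phi i)) -> polyfun (fun y => \prod_(i <- s) phi i y).
Proof.
move=> h; elim: s => [|i s IH].
  by apply: polyfun_ext (polyfun_const 1) => y; rewrite big_nil.
by apply: polyfun_ext (polyfunM (h i) IH) => y; rewrite big_cons.
Qed.

Lemma polyfunX phi n : polyfun phi -> polyfun (fun y => phi y ^+ n).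
Proof. by move=> [P HP]; exists (P ^+ n) => y; rewrite HP rmorphXn. Qed.

Lemma polyfun_meval k (p : {mpoly K[k]}) (g : (T -> K) -> 'I_k -> K) :
  (forall i, polyfun (fun y => g y i)) -> polyfun (fun y => p.@[g y]).
Proof.
move=> /fin_all_exists[P HP]; exists (p \mPo [tuple P i | i < k]) => y.
by rewrite comp_mpoly_meval; apply: meval_eq => i; rewrite tnth_mktuple HP.
Qed.

End Polyfun.

(** The counting argument with denominator 1. *)
Lemma algind_transferT (K : fieldType) (T : finType) (S : (T -> K) -> Prop)
    (k : nat) (g : (T -> K) -> 'I_k -> K) :
  (forall i, polyfun (fun y => g y i)) -> algind S g -> trge S k.
Proof.
move=> /fin_all_exists[P HP] gind.
have [y Sy|y i Sy|c hc] := @algind_transfer _ _ S #|T| (@evT K T) k g 1 P _ _ gind.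
- by rewrite meval1 oner_eq0.
- by rewrite meval1 mul1r HP.
by exists (fun i => enum_val (c i)).
Qed.

Lemma trge_le_card (K : fieldType) (T : finType) (V : (T -> K) -> Prop) k :
  trge V k -> (k <= #|T|)%N.
Proof.
case=> c h; have ic : injective (enum_rank \o c).
  by apply: (@algind_inj K _ V #|T| k (@evT K T)); move=> p p0; apply: h => y Vy;
    rewrite -[RHS](p0 y Vy); apply: meval_eq => i; rewrite /evT /= enum_rankK.
by have := leq_card _ ic; rewrite !card_ord.
Qed.

Section Zariski.
Variables (L : fieldType) (T : finType).
Implicit Types V U : (T -> L) -> Prop.

Lemma zclosed_zeros (I : Type) (Q : I -> Prop) (phi : I -> (T -> L) -> L) :
  (forall i, Q i -> polyfun (phi i)) ->
  zclosed (fun y => forall i, Q i -> phi i y = 0).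
Proof.
move=> h; exists (fun p => exists2 i, Q i & forall y, phi i y = p.@[evT y]) => y.
split=> [h0 p [i Qi <-]|h0 i Qi]; first exact: h0.
by have [P HP] := h i Qi; rewrite HP; apply: h0; exists i.
Qed.

Lemma zclosed_zero phi : polyfun phi -> zclosed (fun y : T -> L => phi y = 0).
Proof.
move=> h; have [P HP] := @zclosed_zeros unit (fun=> True) (fun=> phi) (fun _ _ => h).
by exists P => y; rewrite -HP; split=> [h0 _ _ //|h0]; apply: (h0 tt).
Qed.

Lemma zclosedI V U : zclosed V -> zclosed U -> zclosed (fun y => V y /\ U y).
Proof.
move=> [P HP] [Q HQ]; exists (fun p => P p \/ Q p) => y; rewrite HP HQ.
split=> [[h1 h2] p [/h1|/h2] //|h].
by split=> p hp; apply: h; [left|right].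
Qed.

(** The vanishing ideal of an irreducible set is prime: the zero sets of [phi] and [psi] cover [V],
    so one of them contains it. *)
Lemma zirred_mul V phi psi : zirred V -> polyfun phi -> polyfun psi ->
  (forall y, V y -> phi y * psi y = 0) -> (exists2 y, V y & phi y != 0) ->
  forall y, V y -> psi y = 0.
Proof.
move=> [_ _ irr] fphi fpsi h [y0 Vy0 ny0].
have [y Vy|h1|h1 //] := irr _ _ (zclosed_zero fphi) (zclosed_zero fpsi).
  by have /eqP := h y Vy; rewrite mulf_eq0 => /orP[/eqP|/eqP]; [left|right].
by move/eqP: ny0; case; apply: h1.
Qed.

(* A relation q(f, x_c) = 0 on V can be divided by the largest power of f; setting
   f = 0 in the quotient gives a relation among the x_c on V'. *)
Lemma zirred_trge_lt V V' k : zirred V -> zclosed V' -> subsetP' V' V ->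
  (exists y, V y /\ ~ V' y) -> trge V' k -> trge V k.+1.
Proof.
move=> irr [P HP] sub [y0 [Vy0 nVy0]] [c hc].
have [f fV' fy0] : exists2 f : {mpoly L[#|T|]},
    forall y, V' y -> f.@[evT y] = 0 & f.@[evT y0] != 0.
  apply: NNPP => nex; apply: nVy0; apply/HP => p Pp; apply/eqP/negPn/negP => ny.
  by apply: nex; exists p => // y /HP; apply.
(* Independence is proved for the [k] given coordinates together with [f]; counting then yields
   [k.+1] independent coordinates. *)
pose g (y : T -> L) (i : 'I_k.+1) :=
  if unlift ord_max i is Some j then y (c j) else f.@[evT y].
have gf i : polyfun (fun y => g y i).
  rewrite /g; case: unliftP => [j|] _; first exact: polyfun_coord.
  by exists f.
apply: (algind_transferT gf) => q qV; apply: muni_inj; apply: NNPP => Qn0.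
have [l Ql Qmin] : exists2 l, (muni q)`_l != 0 & forall i, (i < l)%N -> (muni q)`_i = 0.
  have ex : exists l, (muni q)`_l != 0.
    by exists (size (muni q)).-1; rewrite lead_coef_eq0; apply/eqP.
  exists (ex_minn ex); case: ex_minnP => // l _ lmin i.
  by rewrite ltnNge; apply: contraNeq => /lmin.
pose psi y := \sum_(i < size (muni q)) ((muni q)`_(l + i)).@[fun j => y (c j)]
   * f.@[evT y] ^+ i.
have fpsi : polyfun psi.
  apply: polyfun_sum => i; apply: polyfunM.
    by apply: polyfun_meval => j; apply: polyfun_coord.
  by apply: polyfunX; exists f.
have ff : polyfun (fun y => f.@[evT y] ^+ l) by apply: polyfunX; exists f.
have qE y : q.@[g y] = f.@[evT y] ^+ l * psi y.
  rewrite meval_muni /g unlift_none.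
  have sz : (size (map_poly (meval (fun j => y (c j))) (muni q)) <= l + size (muni q))%N.
    by apply: leq_trans (size_poly _ _) (leq_addl _ _).
  rewrite (eq_map_poly (g := meval (fun j => y (c j)))); last first.
    by move=> p; apply: meval_eq => j; rewrite widen_lift liftK.
  rewrite (horner_coef_wide _ sz) big_split_ord /= big1 ?add0r; last first.
    by move=> i _; rewrite coef_map Qmin ?ltn_ord //= meval0 mul0r.
  rewrite mulr_sumr; apply: eq_bigr => i _; rewrite coef_map exprD /=.
  by rewrite mulrCA.
have psi0 : forall y, V y -> psi y = 0.
  apply: (zirred_mul irr ff fpsi) => [y Vy|]; first by rewrite -qE qV.
  by exists y0 => //; rewrite expf_neq0.
case/eqP: Ql; apply: hc => y V'y; have := psi0 y (sub _ V'y).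
have spos : (0 < size (muni q))%N by rewrite size_poly_gt0; apply/eqP.
rewrite /psi fV' // (bigD1 (Ordinal spos)) //= addn0 expr0 mulr1.
rewrite big1 ?addr0 // => i ne; rewrite expr0n.
have -> : (i == 0%N :> nat) = false by apply/negbTE.
by rewrite mulr0.
Qed.

Lemma trge0 V : (exists y, V y) <-> trge V 0.
Proof.
split=> [[y Vy]|[c hc]].
  exists (fun i : 'I_0 => match i with Ordinal _ h => match notF h with end end) => p p0.
  by rewrite (nvar0_mpolyC p); have := p0 y Vy;
    rewrite [in X in X -> _](nvar0_mpolyC p) mevalC => ->; rewrite mpolyC0.
apply: NNPP => nex; have /eqP : 1 = 0 :> {mpoly L[0]}.
  by apply: hc => y Vy; case: nex; exists y.
by rewrite oner_eq0.
Qed.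

(** The bound dim <= tr: a chain starts at a nonempty set, and each strict step gains one
    independent coordinate. *)
Lemma zchain_trge V k : zchain V k -> trge V k.
Proof.
move=> [C [irr inc]].
have h i : (i <= k)%N -> trge (C i) i.
  elim: i => [|i IH] ik; first by apply/trge0; have [[]] := irr 0%N ik.
  have [sub [y [Cy nCy]]] := inc i ik.
  have [Ci _] := irr i (ltnW ik); have [Ci1 _] := irr _ ik.
  apply: (zirred_trge_lt Ci1 _ sub); [by case: Ci|by exists y|exact: IH (ltnW ik)].
have [c hc] := h k (leqnn k); exists c; apply: algind_sub hc.
by have [] := irr k (leqnn k).
Qed.

End Zariski.

(** * Noetherianity *)

(** Past any index there is one where [a] is minimal among all later values; such indices are picked
    repeatedly. *)
Lemma nondecreasing_subseq (a : nat -> nat) : exists s : nat -> nat,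
  (forall i, s i < s i.+1)%N /\ (forall i, a (s i) <= a (s i.+1))%N.
Proof.
have next N : exists i, (N <= i)%N /\ forall j, (N <= j)%N -> (a i <= a j)%N.
  suff h v i : (N <= i)%N -> (a i < v)%N -> exists i, (N <= i)%N /\
      forall j, (N <= j)%N -> (a i <= a j)%N.
    by apply: (h (a N).+1 N).
  elim: v i => [i _|v IH i Ni]; first by rewrite ltn0.
  rewrite ltnS => aiv.
  have [h|] := classic (forall j, (N <= j)%N -> (a i <= a j)%N); first by exists i.
  move=> hn; have [j hj] := not_all_ex_not _ _ hn.
  have [Nj /negP] := imply_to_and _ _ hj; rewrite -ltnNge => lt.
  by apply: (IH j Nj); apply: leq_trans lt aiv.
pose g N := proj1_sig (constructive_indefinite_description _ (next N)).
have gP N : (N <= g N)%N /\ forall j, (N <= j)%N -> (a (g N) <= a j)%N.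
  exact: (proj2_sig (constructive_indefinite_description _ (next N))).
pose s := fix s i := if i is i'.+1 then g (s i').+1 else g 0%N.
have ss i : (s i < s i.+1)%N by have [] := gP (s i).+1.
exists s; split=> // -[|i]; first exact: (proj2 (gP 0%N)).
by apply: (proj2 (gP (s i).+1)); apply: ltn_trans (ss i) (ss i.+1).
Qed.

(** Dickson's lemma: nondecreasing subsequences are extracted for one variable after another. *)
Lemma dickson n (m : nat -> 'X_{1..n}) : exists i j, (i < j)%N /\ (m i <= m j)%MM.
Proof.
suff [s [s1 s2]] : exists s : nat -> nat, (forall i, s i < s i.+1)%N /\
    (forall i t, t \in enum 'I_n -> m (s i) t <= m (s i.+1) t)%N.
  by exists (s 0%N), (s 1%N); split=> //; apply/mnm_lepP => t; apply: s2; rewrite mem_enum.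
elim: (enum 'I_n) => [|t e [s [s1 s2]]]; first by exists id.
have [r [r1 r2]] := nondecreasing_subseq (fun i => m (s i) t).
have s_mono : {homo s : i j / (i < j)%N} by apply: homo_ltn s1; apply: ltn_trans.
exists (s \o r); split=> [i|i u] /=; first exact: s_mono.
rewrite inE => /orP[/eqP-> //|ue].
have mono : {homo (fun i => m (s i) u) : i j / (i <= j)%N}.
  by apply: homo_leq => [//|? ? ?|j]; [apply: leq_trans|apply: s2].
exact/mono/ltnW.
Qed.

Section Noetherian.
Variables (L : fieldType) (T : finType).
Implicit Types V U : (T -> L) -> Prop.

(** Let p_i vanish on C_(i+1) but not on C_i, with minimal leading monomial. By Dickson's lemma the
    leading monomial of some p_i divides that of a later p_j. Cancelling it with a multiple of p_i,
    which vanishes on C_j, gives a polynomial of the same kind as p_j with smaller leading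
    monomial. *)
Lemma zclosed_no_descent (C : nat -> (T -> L) -> Prop) :
  (forall i, zclosed (C i.+1)) -> (forall i, subsetP' (C i.+1) (C i)) ->
  ~ (forall i, exists y, C i y /\ ~ C i.+1 y).
Proof.
move=> cl sub ne.
pose good i (p : {mpoly L[#|T|]}) :=
  (forall y, C i.+1 y -> p.@[evT y] = 0) /\ exists2 y, C i y & p.@[evT y] != 0.
have good0 i p : good i p -> p != 0.
  by move=> [_ [y _]]; apply: contraNneq => ->; rewrite meval0.
have ex i : exists p, good i p.
  have [y [Cy nCy]] := ne i; have [P HP] := cl i.
  apply: NNPP => nex; apply: nCy; apply/HP => p Pp; apply/eqP/negPn/negP => ny.
  apply: nex; exists p; split; last by exists y.
  by move=> z /HP; apply.
have exmin i : exists p, good i p /\ forall q, good i q -> ~ (mlead q < mlead p)%O.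
  have [p] := ex i; move e : (mlead p) => m; move: m p e.
  elim/(well_founded_induction (@ltom_wf #|T|)) => m IH p e gp.
  have [h|] := classic (forall q, good i q -> ~ (mlead q < mlead p)%O).
    by exists p.
  move=> hn; have [q hq] := not_all_ex_not _ _ hn.
  have [gq /NNPP lt] := imply_to_and _ _ hq.
  by apply: (IH (mlead q)) gq => //; rewrite -e.
pose p i := proj1_sig (constructive_indefinite_description _ (exmin i)).
have pP i : good i (p i) /\ forall q, good i q -> ~ (mlead q < mlead (p i))%O.
  exact: (proj2_sig (constructive_indefinite_description _ (exmin i))).
have [i [j [ij le]]] := dickson (fun i => mlead (p i)).
have subij : subsetP' (C j) (C i.+1).
  rewrite -(subnK ij); elim: (j - i.+1)%N => [//|d IH] y.
  by rewrite addSn => /sub /IH.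
have [[pj0 [y Cy pjy]] pjmin] := pP j; have [gi _] := pP i.
have pin0 := good0 _ _ gi; have pjn0 : p j != 0 by apply: (good0 j); case: (pP j).
pose a := mleadc (p j) / mleadc (p i).
have an0 : a != 0 by rewrite mulf_neq0 ?invr_eq0 ?mleadc_eq0.
pose r := a *: ('X_[mlead (p j) - mlead (p i)] * p i).
have rlead : mlead r = mlead (p j).
  rewrite mleadZ // mleadM // -?msupp_eq0 ?msuppX // mleadXm.
  by rewrite submK.
have rleadc : mleadc r = mleadc (p j).
  rewrite mleadcZE mleadcM_proper ?mleadXm ?mcoeffX ?eqxx ?mul1r ?mleadc_eq0 //.
  by rewrite /a divfK // mleadc_eq0.
have r0 z : C j z -> r.@[evT z] = 0.
  move=> Cz; rewrite mevalZ mevalM; case: gi => -> ; last exact: subij.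
  by rewrite !mulr0.
have gq : good j (p j - r).
  split=> [z Cz|]; first by rewrite mevalB pj0 // r0 ?subrr //; apply: sub.
  by exists y => //; rewrite mevalB r0 // subr0.
apply: (pjmin _ gq).
rewrite Order.POrderTheory.lt_neqAle; apply/andP; split; last first.
  apply: Order.POrderTheory.le_trans (mleadB_le _ _) _.
  by rewrite rlead Order.JoinTheory.joinxx.
apply: contraNneq (good0 _ _ gq) => e.
by rewrite -mleadc_eq0 e mcoeffB -[X in _ - _@_X]rlead rleadc subrr.
Qed.

(** Without a minimal element, dependent choice would build an infinite strict descent. *)
Lemma zclosed_min (Q : ((T -> L) -> Prop) -> Prop) V :
  zclosed V -> Q V -> exists U, [/\ zclosed U, subsetP' U V, Q U &
    forall U', zclosed U' -> Q U' -> subsetP' U' U -> subsetP' U U'].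
Proof.
move=> clV QV; apply: NNPP => nex.
pose D := {U : (T -> L) -> Prop | [/\ zclosed U, subsetP' U V & Q U]}.
have next (U : D) : exists U' : D, subsetP' (sval U') (sval U) /\
    exists y, sval U y /\ ~ sval U' y.
  case: U => U [clU subU QU] /=; apply: NNPP => nex'; apply: nex; exists U.
  split=> // U' clU' QU' subU' y Uy; apply: NNPP => nU'y; apply: nex'.
  have h : [/\ zclosed U', subsetP' U' V & Q U'] by split=> // z /subU' /subU.
  by exists (exist _ U' h); split=> //; exists y.
pose f (U : D) := proj1_sig (constructive_indefinite_description _ (next U)).
have fP (U : D) : subsetP' (sval (f U)) (sval U) /\ exists y, sval U y /\ ~ sval (f U) y.
  exact: (proj2_sig (constructive_indefinite_description _ (next U))).
have h0 : [/\ zclosed V, subsetP' V V & Q V] by split.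
pose s := fix s i := if i is i'.+1 then f (s i') else exist _ V h0 : D.
apply: (@zclosed_no_descent (fun i => sval (s i))) => i /=.
- by case: (f (s i)) => U [].
- by case: (fP (s i)).
- by case: (fP (s i)).
Qed.

(** A minimal zero set among those of finite subsets of [P] cannot shrink when one more equation is
    added. Finiteness is what makes [V] definable by a first-order formula. *)
Lemma zclosed_finite V : zclosed V -> exists s : seq {mpoly L[#|T|]},
  forall y, V y <-> (forall p, p \in s -> p.@[evT y] = 0).
Proof.
move=> [P HP].
pose Q U := exists s : seq {mpoly L[#|T|]}, (forall p, p \in s -> P p) /\
  forall y, U y <-> (forall p, p \in s -> p.@[evT y] = 0).
have [||U [_ _ [s [sP sU]] Umin]] := @zclosed_min Q (fun=> True).
- by exists (fun=> False).
- by exists [::].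
exists s => y; rewrite HP; split=> [h p /sP /h //|/sU Uy p Pp].
have : subsetP' U (fun y => U y /\ p.@[evT y] = 0).
  apply: Umin => [||z []//].
  - apply: zclosedI; first by exists (fun p => p \in s).
    by apply: zclosed_zero; exists p.
  - exists (p :: s); split=> [q|z]; first by rewrite inE => /orP[/eqP->|/sP].
    split=> [[/sU h0 h1] q|h]; first by rewrite inE => /orP[/eqP->|/h0].
    by split; [apply/sU => q qs|]; apply: h; rewrite inE ?qs ?orbT ?eqxx.
by move=> /(_ y Uy)[].
Qed.

(** A minimal closed subset with independent [c] is irreducible: if two closed sets cover it,
    independence survives on one of the two pieces, which by minimality is everything. *)
Lemma algind_zirred V k (c : 'I_k -> T) :
  zclosed V -> algind V (fun y i => y (c i)) ->
  exists U, [/\ zirred U, subsetP' U V & algind U (fun y i => y (c i))].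
Proof.
move=> clV /(zclosed_min (Q := fun U => algind U (fun y i => y (c i))) clV).
move=> [U [clU sub ind Umin]]; exists U; split=> //; split=> //.
  apply: NNPP => nex; have /eqP : 1 = 0 :> {mpoly L[k]}.
    by apply: ind => y Uy; case: nex; exists y.
  by rewrite oner_eq0.
move=> A B clA clB UAB.
have : algind (fun y => exists b : bool, U y /\ (if b then A y else B y))
    (fun y i => y (c i)).
  by apply: algind_sub ind => y Uy; case: (UAB y Uy); [exists true|exists false].
move=> /algind_union[[] ind'].
- by left=> y Uy; case: (Umin _ (zclosedI clU clA) ind' _ y Uy) => // z [].
- by right=> y Uy; case: (Umin _ (zclosedI clU clB) ind' _ y Uy) => // z [].
Qed.

End Noetherian.

(** * Quantifier elimination and the existence of chains *)

Section QuantifierElimination.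
Variable F : fieldType.

Lemma term_of_mpoly n (v : 'I_n -> nat) (p : {mpoly F[n]}) :
  exists t : GRing.term F, forall e, GRing.eval e t = p.@[fun i => e`_(v i)]%R.
Proof.
elim/mpolyind: p => [|a m p _ _ [t Ht]].
  by exists (GRing.Const 0%R) => e; rewrite meval0.
suff [u Hu] : exists u : GRing.term F, forall e,
    (GRing.eval e u = \prod_i e`_(v i) ^+ m i)%R.
  exists (GRing.Add (GRing.Mul (GRing.Const a) u) t) => e /=.
  by rewrite Ht Hu mevalD mevalZ mevalX.
elim: (index_enum _) => [|i s [u Hu]].
  by exists (GRing.Const 1%R) => e; rewrite big_nil.
exists (GRing.Mul (GRing.Exp (GRing.Var _ (v i)) (m i)) u) => e /=.
by rewrite big_cons Hu.
Qed.

Lemma formula_all (I : eqType) (s : seq I) (P : I -> GRing.formula F) :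
  exists f, forall e, GRing.holds e f <-> (forall i, i \in s -> GRing.holds e (P i)).
Proof.
elim: s => [|i s [f Hf]]; first by exists (GRing.Bool true).
exists (GRing.And (P i) f) => e /=; rewrite Hf; split=> [[h0 h] j|h].
  by rewrite inE => /orP[/eqP->|/h].
by split=> [|j js]; apply: h; rewrite inE ?js ?orbT ?eqxx.
Qed.

Variables (k : nat) (env : ('I_k -> F) -> seq F).
Hypothesis env_poly :
  forall j, exists P : {mpoly F[k]}, forall u, ((env u)`_j = P.@[u])%R.

Lemma rterm_poly t : GRing.rterm t ->
  exists P : {mpoly F[k]}, forall u, GRing.eval (env u) t = P.@[u]%R.
Proof.
elim: t => //= [a|n|t1 IH1 t2 IH2|t IH|t IH n|t1 IH1 t2 IH2|t IH n].
- by exists a%:MP => u; rewrite mevalC.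
- by exists n%:R => u; rewrite rmorph_nat.
- by move=> /andP[/IH1[P HP] /IH2[Q HQ]]; exists (P + Q)%R => u; rewrite mevalD HP HQ.
- by move=> /IH[P HP]; exists (- P)%R => u; rewrite mevalN HP.
- by move=> /IH[P HP]; exists (P *+ n)%R => u; rewrite mevalMn HP.
- by move=> /andP[/IH1[P HP] /IH2[Q HQ]]; exists (P * Q)%R => u; rewrite mevalM HP HQ.
- by move=> /IH[P HP]; exists (P ^+ n)%R => u; rewrite rmorphXn /= HP.
Qed.

(** An atomic equation P = Q is either an identity or false wherever P - Q is nonzero. Hence the
    truth value is constant off the zeros of some nonzero [h]. *)
Lemma qf_generic f : GRing.qf_form f -> GRing.rformula f ->
  exists (h : {mpoly F[k]}) (b : bool), (h != 0)%R /\
    forall u, (h.@[u] != 0)%R -> GRing.qf_eval (env u) f = b.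
Proof.
have two (op : bool -> bool -> bool) f1 f2 :
  (exists (h : {mpoly F[k]}) (b : bool), (h != 0)%R /\
    forall u, (h.@[u] != 0)%R -> GRing.qf_eval (env u) f1 = b) ->
  (exists (h : {mpoly F[k]}) (b : bool), (h != 0)%R /\
    forall u, (h.@[u] != 0)%R -> GRing.qf_eval (env u) f2 = b) ->
  exists (h : {mpoly F[k]}) (b : bool), (h != 0)%R /\
    forall u, (h.@[u] != 0)%R ->
      op (GRing.qf_eval (env u) f1) (GRing.qf_eval (env u) f2) = b.
  move=> [h1 [b1 [n1 H1]]] [h2 [b2 [n2 H2]]]; exists (h1 * h2)%R, (op b1 b2).
  split=> [|u]; first by rewrite mulf_neq0.
  by rewrite mevalM mulf_eq0 negb_or => /andP[/H1-> /H2->].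
elim: f => //= [b|t1 t2|f1 IH1 f2 IH2|f1 IH1 f2 IH2|f1 IH1 f2 IH2|f IH].
- by exists 1%R, b; rewrite oner_eq0.
- move=> _ /andP[/rterm_poly[P HP] /rterm_poly[Q HQ]].
  have [e|ne] := eqVneq P Q.
    by exists 1%R, true; split=> [|u _]; [exact: oner_neq0|rewrite HP HQ e eqxx].
  exists (P - Q)%R, false; split=> [|u]; first by rewrite subr_eq0.
  by rewrite mevalB subr_eq0 HP HQ => /negbTE.
- by move=> /andP[/IH1 h1 /IH2 h2] /andP[/h1 {}h1 /h2 {}h2]; apply: (two andb).
- by move=> /andP[/IH1 h1 /IH2 h2] /andP[/h1 {}h1 /h2 {}h2]; apply: (two orb).
- by move=> /andP[/IH1 h1 /IH2 h2] /andP[/h1 {}h1 /h2 {}h2]; apply: (two implb).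
- move=> /IH h /h [h1 [b [n1 H1]]]; exists h1, (~~ b); split=> // u /H1 ->.
  by [].
Qed.

End QuantifierElimination.

Lemma zclosed_ext (L : fieldType) (T : finType) (V : (T -> L) -> Prop) y z :
  zclosed V -> y =1 z -> V y -> V z.
Proof.
move=> [P HP] e /HP h; apply/HP => p /h <-.
by apply: meval_eq => i; rewrite /evT e.
Qed.

Section Closed.
Variables (L : closedFieldType) (T : finType).
Implicit Types V U : (T -> L) -> Prop.

Lemma closed_infinite (s : seq L) : exists x, x \notin s.
Proof.
have /closed_nonrootP[x] : \prod_(a <- s) ('X - a%:P) != 0.
  by apply/monic_neq0/monic_prod_XsubC.
by rewrite root_prod_XsubC; exists x.
Qed.

Lemma zclosed_formula V (v : T -> nat) : zclosed V -> exists f : GRing.formula L,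
  forall e, GRing.holds e f <-> V (fun t => e`_(v t)).
Proof.
move=> /zclosed_finite[s sV].
have /fin_all_exists[t Ht] (i : 'I_(size s)) := term_of_mpoly
  (fun j => v (enum_val j)) s`_i.
have [f Hf] := formula_all (enum 'I_(size s))
  (fun i => GRing.Equal (t i) (GRing.Const 0)).
exists f => e; rewrite Hf sV; split=> [h p ps|h i _] /=.
  have lt : (index p s < size s)%N by rewrite index_mem.
  have := h (Ordinal lt); rewrite mem_enum => /(_ isT) /=.
  by rewrite Ht /= nth_index.
by rewrite Ht /=; apply: h; apply: mem_nth.
Qed.

(* By quantifier elimination the image of V in L^k is constructible; since it is
   Zariski dense, it contains a nonempty principal open set. *)
Lemma dominant_image V k (c : 'I_k -> T) : zclosed V ->
  algind V (fun y i => y (c i)) -> exists2 h : {mpoly L[k]}, h != 0 &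
    forall u, h.@[u] != 0 -> exists y, V y /\ forall i, y (c i) = u i.
Proof.
move=> clV ind; pose n := #|T|.
have [f Hf] := zclosed_formula (fun t => enum_rank t) clV.
have [g Hg] := formula_all (enum 'I_k)
  (fun i => GRing.Equal (GRing.Var L (enum_rank (c i))) (GRing.Var L (n + i))).
(* Variables 0, .., n-1 carry the point of [V] and are quantified; variables n, .., n+k-1 carry its
   prescribed image [u]. *)
pose phi := GRing.to_rform (foldr GRing.Exists (GRing.And f g) (iota 0 n)).
pose env (u : 'I_k -> L) := nseq n 0 ++ [seq u i | i <- enum 'I_k].
have envE u (i : 'I_k) : (env u)`_(n + i) = u i.
  rewrite nth_cat size_nseq ltnNge leq_addr /= addKn (nth_map i) ?size_enum_ord //.
  by rewrite nth_ord_enum.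
have phiP u : GRing.holds (env u) phi <-> exists y, V y /\ forall i, y (c i) = u i.
  rewrite /phi; split=> [/GRing.to_rformP/GRing.foldExistsP[e' ee' /= []]|[y [Vy yc]]].
    move=> /Hf Vy /Hg h; exists (fun t => e'`_(enum_rank t)); split=> // i.
    have := h i; rewrite mem_enum => /(_ isT) /= ->.
    by rewrite -ee' ?envE // !inE mem_iota add0n -leqNgt leq_addr.
  apply/GRing.to_rformP/GRing.foldExistsP.
  pose e' := [seq y t | t <- enum T] ++ [seq u i | i <- enum 'I_k].
  have sz : size [seq y t | t <- enum T] = n by rewrite size_map -cardE.
  have e1 t : e'`_(enum_rank t) = y t.
    by rewrite nth_cat sz ltn_ord (nth_map t) -?cardE // nth_enum_rank.
  have e2 i : (n <= i)%N -> (env u)`_i = e'`_i.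
    by move=> ni; rewrite !nth_cat size_nseq sz ltnNge ni.
  exists e' => [i|].
    by rewrite !inE mem_iota add0n -leqNgt; apply: e2.
  split=> /=; first by apply/Hf; apply: zclosed_ext Vy => // t; rewrite e1.
  by apply/Hg => i _ /=; rewrite e1 yc -e2 ?leq_addr ?envE.
have rphi : GRing.rformula phi by apply: GRing.to_rform_rformula.
have wf := @ClosedFieldQE.wf_ex_elim L.
have ok := ClosedFieldQE.holds_ex_elim (@GRing.solve_monicpoly L).
have /andP[qf rf] := GRing.quantifier_elim_wf wf rphi.
have env_poly j : exists P : {mpoly L[k]}, forall u, (env u)`_j = P.@[u].
  have [lt|ge] := ltnP j n.
    by exists 0 => u; rewrite nth_cat size_nseq lt nth_nseq lt meval0.
  have [lt|ge'] := ltnP (j - n) k.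
    by exists 'X_(Ordinal lt) => u; rewrite mevalXU -envE /= subnKC.
  exists 0 => u; rewrite meval0 nth_default // size_cat size_nseq size_map.
  by rewrite size_enum_ord -leq_subRL.
have [h [b [hn0 hb]]] := qf_generic env_poly qf rf.
exists h => // u hu; apply/phiP/(GRing.quantifier_elim_rformP wf ok _ rphi).
(* Were the generic truth value false, [h] would vanish on the whole image of [V], against
   independence. *)
rewrite hb //; case: b hb => // hb; case/eqP: hn0; apply: ind => y Vy.
apply/eqP/negPn/negP => hy; have /negP := hb _ hy; apply.
by apply/(GRing.quantifier_elim_rformP wf ok _ rphi)/phiP; exists y.
Qed.

(** The bound tr <= dim: a chain in a hyperplane slice of the irreducible [U] is extended by [U]
    itself, which is not contained in the slice since its last chosen coordinate is not constant. *)
Lemma trge_zchain V k : zclosed V -> trge V k -> zchain V k.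
Proof.
elim: k V => [|k IH] V clV [c ind].
  have [U [irr sub _]] := algind_zirred clV ind.
  by exists (fun=> U); split.
have [U [irr sub indU]] := algind_zirred clV ind.
have clU : zclosed U by case: irr.
have [h hn0 hU] := dominant_image clU indU.
have [v hv] := mpoly_nonzero_point closed_infinite hn0.
(* Taking [a] from a point where [h] is nonzero keeps [h] a nonzero polynomial after its last
   variable is set to [a]. *)
pose a := v ord_max; pose W y := U y /\ y (c ord_max) - a = 0.
have clW : zclosed W.
  apply: zclosedI clU (zclosed_zero _); apply: polyfunD (polyfun_coord _ _) _.
  exact: polyfun_const.
have indW : algind W (fun y i => y (c (widen i))).
  pose ext (u : 'I_k -> L) (i : 'I_k.+1) := if unlift ord_max i is Some j then u j else a.
  pose ha := h \mPo [tuple (if unlift ord_max i is Some j then 'X_j else a%:MP)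
    : {mpoly L[k]} | i < k.+1].
  have haE u : ha.@[u] = h.@[ext u].
    rewrite /ha comp_mpoly_meval; apply: meval_eq => i; rewrite tnth_mktuple /ext.
    by case: unliftP => [j|] _; rewrite ?mevalXU ?mevalC.
  have han0 : ha != 0.
    have : ha.@[fun i => v (widen i)] != 0.
      rewrite haE (meval_eq (v2 := v)) // => i; rewrite /ext.
      by case: unliftP => [j ->|->] //; rewrite widen_lift.
    by apply: contraNneq => ->; rewrite meval0.
  (* Where [ha] is nonzero the point lifts to the slice, on which [p] vanishes; so the product is
     zero everywhere. *)
  move=> p pW; have : p * ha = 0.
    apply: (algind_id closed_infinite) => u _; rewrite mevalM.
    have [->|hu] := eqVneq ha.@[u] 0; first by rewrite mulr0.
    rewrite haE in hu; have [y [Uy yc]] := hU _ hu.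
    rewrite (meval_eq (v2 := fun i => y (c (widen i)))) ?pW ?mul0r //.
      split=> //; rewrite yc /ext unlift_none.
      by rewrite subrr.
    by move=> i; rewrite yc /ext widen_lift liftK.
  by move/eqP; rewrite mulf_eq0 (negbTE han0) orbF => /eqP.
have [C [Cirr Cinc]] : zchain W k by apply: IH => //; exists (fun i => c (widen i)).
have WU : subsetP' W U by move=> y [].
have [y Uy ya] : exists2 y, U y & y (c ord_max) - a != 0.
  apply: NNPP => nex.
  have /(congr1 (mcoeff U_(ord_max))) : 'X_ord_max - a%:MP = 0 :> {mpoly L[k.+1]}.
    apply: indU => y Uy; rewrite mevalB mevalXU mevalC; apply/eqP/negPn/negP => ya.
    by apply: nex; exists y.
  rewrite mcoeffB mcoeffXU mcoeffC eqxx mnm1_eq0 mulr0 subr0 mcoeff0 => /eqP.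
  by rewrite oner_eq0.
exists (fun i => if (i <= k)%N then C i else U); split=> i.
  rewrite leq_eqVlt => /orP[/eqP->|]; first by rewrite ltnn.
  rewrite ltnS => ik; rewrite ik; have [irrC subC] := Cirr i ik; split=> //.
  by move=> z /subC /WU /sub.
rewrite ltnS => ik; rewrite ik; move: (ik); rewrite leq_eqVlt => /orP[/eqP->|lt].
  rewrite ltnn; have [_ subC] := Cirr k (leqnn k).
  split; first by move=> z /subC /WU.
  by exists y; split=> // /subC[_ /eqP]; apply/negP.
by rewrite lt; apply: Cinc.
Qed.

End Closed.

(** * Codimension and descent to the base field *)

Lemma ex_max (P : nat -> Prop) N : P 0%N -> (forall k, P k -> (k <= N)%N) ->
  exists k, P k /\ forall k', P k' -> (k' <= k)%N.
Proof.
move=> P0; elim: N => [|N IH] bd; first by exists 0%N.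
have [PN|nPN] := classic (P N.+1); first by exists N.+1.
apply: IH => k Pk; move: (bd k Pk); rewrite leq_eqVlt => /orP[/eqP e|//].
by case: nPN; rewrite -e.
Qed.

(** The order with [None] as +infinity. A value is determined by its finite upper bounds, which
    reduces the final equality to an equivalence. *)
Definition ole (o : option nat) (e : nat) : bool :=
  if o is Some a then (a <= e)%N else false.

Lemma ole_ext o o' : (forall e, ole o e = ole o' e) -> o = o'.
Proof.
case: o o' => [a|] [b|] //= h; last 2 first.
- by have := h a; rewrite leqnn.
- by have := h b; rewrite leqnn.
by congr Some; apply/eqP; rewrite eqn_leq h leqnn -h leqnn.
Qed.

Lemma ole_omin (o o' : option nat) e : ole (omin o o') e = ole o e || ole o' e.
Proof. by case: o o' => [a|] [b|] //=; rewrite ?geq_min ?orbF. Qed.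

Lemma ole_bigomin n (o : 'I_n -> option nat) e :
  ole (\big[omin/None]_r o r) e = [exists r, ole (o r) e].
Proof.
transitivity (has (fun r => ole (o r) e) (index_enum 'I_n)).
  elim: (index_enum _) => [|r s IH]; first by rewrite big_nil.
  by rewrite big_cons ole_omin IH.
apply/hasP/existsP => [[r _ h]|[r h]]; first by exists r.
by exists r => //; rewrite mem_index_enum.
Qed.

(** Boundedness of tr by [#|T|] provides a maximal k, so the dimension chosen by [epsilon] really is
    one. The additive form sidesteps truncated subtraction. *)
Lemma zcodim_le (L : closedFieldType) (T : finType) (V : (T -> L) -> Prop) e :
  zclosed V -> ole (zcodim V) e <-> exists2 k, trge V k & (#|T| <= k + e)%N.
Proof.
move=> clV; have : dim_is V (zdim V).
  apply: epsilon_spec; have [ne|em] := classic (exists y, V y); last first.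
    by exists None => y Vy; apply: em; exists y.
  have /trge0 t0 := ne; have [k [tk kmax]] := ex_max t0 (@trge_le_card _ _ V).
  exists (Some k); split=> [|k' /zchain_trge /kmax //].
  exact: trge_zchain.
rewrite /zcodim; case: (zdim V) => [k [ch kmax]|em] /=; last first.
  split=> // -[k [c ind] _]; exfalso.
  have /eqP := ind 1 (fun y Vy => False_ind _ (em y Vy)).
  by rewrite oner_eq0.
rewrite leq_subLR; split=> [h|[k' /(trge_zchain clV) /kmax le h]].
  by exists k => //; apply: zchain_trge.
by apply: leq_trans h _; rewrite leq_add2r.
Qed.

Section Descent.
Variables (K L : fieldType) (iota : {rmorphism K -> L}).

Lemma meval_map_mpoly n (p : {mpoly K[n]}) (v : 'I_n -> K) :
  (map_mpoly iota p).@[fun i => iota (v i)] = iota p.@[v].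
Proof.
elim/mpolyind: p => [|a m p _ _ IH]; first by rewrite !raddf0.
rewrite !raddfD /= IH map_mpolyZ map_mpolyX !mevalZ !mevalX rmorphM rmorph_prod.
by congr (_ * _ + _); apply: eq_bigr => i _; rewrite rmorphXn.
Qed.

(** The conditions have coefficients in [K]. If their rows span everything, the identity matrix is a
    [K]-combination of them, which survives [iota] and forces [a = 0]; otherwise a nonzero solution
    exists over [K]. *)
Lemma rank_descent (X : Type) (S : X -> Prop) (n : nat) (phi : X -> 'rV[K]_n)
    (a : 'cV[L]_n) : a != 0 ->
  (forall y, S y -> map_mx iota (phi y) *m a = 0) ->
  exists2 b : 'cV[K]_n, b != 0 & forall y, S y -> phi y *m b = 0.
Proof.
move=> an0 Sa.
(* Finitely many rows of maximal rank replace the possibly infinite system. *)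
pose P r := exists N (A : 'M[K]_(N, n)), \rank A = r /\
  forall i, exists y, S y /\ row i A = phi y.
have P0 : P 0%N by exists 0%N, 0; split; [exact: mxrank0|case].
have [r [[N [A [rA AS]]] rmax]] : exists r, P r /\ forall r', P r' -> (r' <= r)%N.
  by apply: (ex_max (N := n) P0) => r [N [A [<- _]]]; apply: rank_leq_col.
have subA y : S y -> (phi y <= A)%MS.
  move=> Sy; suff le : (\rank (col_mx A (phi y)) <= \rank A)%N.
    have sAc : (A <= col_mx A (phi y))%MS.
      by apply: submx_trans (addsmxSl _ _) _; rewrite addsmxE.
    have /andP[_ sc] : (A == col_mx A (phi y))%MS.
      by rewrite -(geq_leqif (mxrank_leqif_eq sAc)).
    by apply: submx_trans sc; apply: submx_trans (addsmxSr A _) _; rewrite addsmxE.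
  rewrite rA; apply: rmax; exists (N + 1)%N, (col_mx A (phi y)); split=> // i.
  case: (split_ordP i) => j ->.
    by have [z [Sz zE]] := AS j; exists z; split=> //; rewrite rowKu.
  by exists y; split=> //; rewrite rowKd row_id // ord1.
have [full|nfull] := boolP (row_full A).
  have /row_fullP[B BA] := full; case/eqP: an0.
  have Aa : map_mx iota A *m a = 0.
    apply/row_matrixP => i; rewrite row_mul row0 -map_row.
    by have [y [Sy ->]] := AS i; apply: Sa.
  by rewrite -[a]mul1mx -(map_mx1 iota) -BA map_mxM -mulmxA Aa mulmx0.
have kn0 : nz_row (kermx A^T) != 0.
  rewrite nz_row_eq0 -mxrank_eq0 mxrank_ker mxrank_tr -lt0n subn_gt0.
  by rewrite ltn_neqAle nfull rank_leq_col.
exists (nz_row (kermx A^T))^T; first by rewrite trmx_eq0.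
move=> y /subA /submxP[B ->]; rewrite -mulmxA -[X in _ *m X]trmxK trmx_mul trmxK.
have /sub_kermxP -> := nz_row_sub (kermx A^T).
by rewrite trmx0 mulmx0.
Qed.

Variable T : finType.
Implicit Type S : (T -> K) -> Prop.

Lemma zclosure_closed S : zclosed (zclosure iota S).
Proof.
exists (fun q => exists p, (forall x, S x -> p.@[evT x] = 0) /\ q = map_mpoly iota p) => y.
by split=> [h q [p [pS ->]]|h p pS]; apply: h => //; exists p.
Qed.

Lemma zclosure_sub S x : S x -> zclosure iota S (fun t => iota (x t)).
Proof.
by move=> Sx p pS; rewrite (meval_map_mpoly p (evT x)) pS // rmorph0.
Qed.

(** A relation over [K] on [S] holds on the closure by definition. Conversely, the coefficients of a
    relation over [L] solve a linear system whose rows are the monomials evaluated at points of [S];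
    a nonzero solution over [K] is a relation on [S]. *)
Lemma trge_zclosure S k : trge (zclosure iota S) k <-> trge S k.
Proof.
split=> -[c ind]; exists c => p pS.
  suff p0 : map_mpoly iota p = 0.
    apply/mpolyP => m; apply: (fmorph_inj iota).
    by rewrite -mcoeff_map_mpoly p0 !mcoeff0 rmorph0.
  apply: ind => y Sy.
  have := Sy (rename (fun i => enum_rank (c i)) p).
  have -> : map_mpoly iota (rename (fun i => enum_rank (c i)) p) =
      rename (fun i => enum_rank (c i)) (map_mpoly iota p).
    rewrite /rename map_mpoly_comp; last exact: fmorph_inj.
    congr (_ \mPo _); apply: eq_from_tnth => i.
    by rewrite tnth_map !tnth_mktuple map_mpolyX.
  rewrite meval_rename => h; rewrite -[RHS]h; last first.
    move=> x Sx; rewrite meval_rename -[RHS](pS x Sx).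
    by apply: meval_eq => i; rewrite /evT enum_rankK.
  by apply: meval_eq => i; rewrite /evT enum_rankK.
apply/eqP/negPn/negP => pn0.
pose E : finType := 'X_{1..k < msize p}.
pose ev (j : 'I_#|E|) : 'X_{1..k} := (enum_val j : 'X_{1..k < msize p}).
pose mon (x : T -> K) := \row_(j < #|E|) 'X_[ev j].@[fun i => x (c i)].
pose a : 'cV[L]_#|E| := \col_j p@_(ev j).
have an0 : a != 0.
  have lt : (mdeg (mlead p) < msize p)%N by rewrite msize_mdeg_lt ?mlead_supp.
  apply: contraNneq pn0 => /matrixP /(_ (enum_rank (BMultinom lt)) 0).
  by rewrite !mxE /ev enum_rankK /= => /eqP; rewrite mleadc_eq0.
have [x Sx|b /cV0Pn[j0 bj0] bS] := rank_descent an0 (S := S) (phi := mon).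
  apply/matrixP => i j; rewrite !mxE -[RHS](pS _ (zclosure_sub Sx)).
  rewrite [in RHS](mpolywE (leqnn (msize p))) raddf_sum /=.
  rewrite [RHS](reindex (@enum_val E predT)); last exact: onW_bij (enum_val_bij _).
  apply: eq_bigr => l _; rewrite !mxE mulrC mevalZ; congr (_ * _).
  by rewrite -(meval_map_mpoly _ (fun i => x (c i))) map_mpolyX.
pose q : {mpoly K[k]} := \sum_j b j 0 *: 'X_[ev j].
have : q@_(ev j0) = b j0 0.
  rewrite raddf_sum /= (bigD1 j0) //= mcoeffZ mcoeffX eqxx mulr1 big1 ?addr0 //.
  move=> j ne; rewrite mcoeffZ mcoeffX /ev -bmeqP (inj_eq enum_val_inj) (negbTE ne).
  by rewrite mulr0.
have -> : q = 0.
  apply: ind => x Sx; have /matrixP/(_ 0 0) := bS x Sx; rewrite !mxE => <-.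
  rewrite raddf_sum; apply: eq_bigr => j _ /=.
  by rewrite mevalZ mxE mulrC.
by rewrite mcoeff0 => e; rewrite -e eqxx in bj0.
Qed.

End Descent.

(** * Multilinear maps *)

Section PolyfunMatrix.
Variables (K : fieldType) (T : finType).

Lemma polyfun_det n (M : (T -> K) -> 'M[K]_n) :
  (forall i j, polyfun (fun z => M z i j)) -> polyfun (fun z => \det (M z)).
Proof.
move=> h; apply: polyfun_sum => s; apply: polyfunM; first exact: polyfun_const.
exact: polyfun_prod.
Qed.

Lemma polyfun_adj n (M : (T -> K) -> 'M[K]_n) i j :
  (forall i j, polyfun (fun z => M z i j)) -> polyfun (fun z => (\adj (M z)) i j).
Proof.
move=> h; apply: (@polyfun_ext _ _ _ (fun z => cofactor (M z) j i)).
  by move=> z; rewrite mxE.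
apply: polyfunM; first exact: polyfun_const.
apply: polyfun_det => i' j'.
by apply: polyfun_ext (h (lift j i') (lift i j')) => z; rewrite !mxE.
Qed.

Lemma polyfun_mulmx m n p (M : (T -> K) -> 'M[K]_(m, n)) (N : (T -> K) -> 'M[K]_(n, p)) :
  (forall i j, polyfun (fun z => M z i j)) -> (forall i j, polyfun (fun z => N z i j)) ->
  forall i j, polyfun (fun z => (M z *m N z) i j).
Proof.
move=> hM hN i j.
apply: (@polyfun_ext _ _ _ (fun z => \sum_k M z i k * N z k j)).
  by move=> z; rewrite mxE.
by apply: polyfun_sum => k; apply: polyfunM.
Qed.

Lemma polyfun_comp (T' : finType) (phi : (T' -> K) -> K) (g : (T -> K) -> T' -> K) :
  polyfun phi -> (forall t, polyfun (fun z => g z t)) -> polyfun (fun z => phi (g z)).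
Proof.
move=> [P HP] hg; apply: (polyfun_ext (fun z => HP (g z))).
by apply: polyfun_meval => i; apply: hg.
Qed.

End PolyfunMatrix.

(** [f] selects a maximal independent set of rows, [g] columns on which these rows form an
    invertible matrix. *)
Lemma max_minor (K : fieldType) n m (A : 'M[K]_(n, m)) r : \rank A = r ->
  exists (f : {ffun 'I_r -> 'I_n}) (g : {ffun 'I_r -> 'I_m}),
    (A <= rowsub f A)%MS /\ \det (mxsub f g A) != 0.
Proof.
move=> <-; pose f := maxrankfun A; exists f.
have rf : row_full (rowsub f A)^T.
  by rewrite /row_full mxrank_tr; apply: maxrowsub_free.
exists (fullrankfun rf); split; first by rewrite eq_maxrowsub.
have := fullrowsub_unit rf; rewrite unitmxE unitfE -det_tr.
by congr (\det _ != 0); apply/matrixP => i j; rewrite !mxE.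
Qed.

Lemma algind_subfamily (K : fieldType) (X : Type) (S : X -> Prop) k k'
    (g : X -> 'I_k -> K) (e : 'I_k' -> 'I_k) :
  injective e -> algind S g -> algind S (fun y i => g y (e i)).
Proof.
move=> ie ind p pS; apply: (rename_eq0 ie); apply: ind => y Sy.
by rewrite meval_rename pS.
Qed.

Lemma algind_nonempty (K : fieldType) (X : Type) (S : X -> Prop) k
  (g : X -> 'I_k -> K) : algind S g -> exists y, S y.
Proof.
move=> ind; apply: NNPP => nex; have /eqP : 1 = 0 :> {mpoly K[k]}.
  by apply: ind => y Sy; case: nex; exists y.
by rewrite oner_eq0.
Qed.

(** [S] is stable under changing the coordinates in [js], so these can be adjoined one at a time
    with full fibers. *)
Lemma algind_free_coords (K : fieldType)
    (K_infinite : forall s : seq K, exists x : K, x \notin s)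
    (T : finType) (S : (T -> K) -> Prop) (js : seq T) k (c : 'I_k -> T) :
  uniq js -> (forall i, c i \notin js) ->
  (forall x x', S x -> (forall t, t \notin js -> x' t = x t) -> S x') ->
  algind S (fun x i => x (c i)) ->
  exists c' : 'I_(size js + k) -> T, algind S (fun x i => x (c' i)) /\
    forall i, c' i \in js \/ exists i0, c' i = c i0.
Proof.
elim: js => [|j js IH] /=.
  by move=> _ _ _ ind; exists c; split=> // i; right; exists i.
move=> /andP[jjs ujs] cj Sinv ind.
have [||||c' [ind' c'j]] := IH.
- by [].
- by move=> i; have := cj i; rewrite inE negb_or => /andP[].
- move=> x x' Sx h; apply: Sinv Sx _ => t; rewrite inE negb_or => /andP[_].
  exact: h.
- exact: ind.
have c'nj i : c' i != j.
  case: (c'j i) => [h|[i0 ->]]; first by apply: contraNneq jjs => <-.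
  by have := cj i0; rewrite inE negb_or => /andP[].
exists (fun i : 'I_(size js + k).+1 => if unlift ord_max i is Some i' then c' i' else j).
split; last first.
  move=> i; case: unliftP => [i'|] _; last by left; rewrite inE eqxx.
  by case: (c'j i') => [h|h]; [left; rewrite inE h orbT|right].
apply: (algind_fiber K_infinite (S0 := S) (g0 := fun x i => x (c' i))) => // y t Sy.
exists (fun u => if u == j then t else y u); split.
- apply: Sinv Sy _ => u; rewrite inE negb_or => /andP[/negbTE-> _] //.
- by move=> i; rewrite widen_lift liftK (negbTE (c'nj i)).
- by rewrite unlift_none eqxx.
Qed.

Section Multilinear.
Variables (K : fieldType) (d : nat) (ns : 'I_d -> nat) (m : nat).
Variable F : (blk ns -> K) -> 'rV[K]_m.
Hypothesis F_multi : multilinear F.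

Definition coordb (i : 'I_d) (k : 'I_(ns i)) : blk ns := Tagged (fun i => 'I_(ns i)) k.

Lemma coordbP i (t : blk ns) : tag t = i -> exists k, t = coordb (i := i) k.
Proof. by case: t => j k /= ji; subst j; exists k. Qed.

Lemma coordb_inj i : injective (@coordb i).
Proof. by move=> k k' /eqP; rewrite eq_Tagged => /eqP. Qed.

(** Multilinearity in block [i] with scalar 0 only compares points coordinatewise, so it identifies
    the values at pointwise equal functions. *)
Lemma multilinear_ext (i : 'I_d) x z : x =1 z -> F x = F z.
Proof.
move=> e; have := @F_multi i 0 x x z; rewrite scale0r add0r => -> //.
by move=> t _; rewrite mul0r add0r e.
Qed.

Lemma multilinear_entry (i : 'I_d) x z j : x =1 z -> F x 0 j = F z 0 j.
Proof. by move=> /(multilinear_ext i) ->. Qed.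

Definition updb (i : 'I_d) (y x : blk ns -> K) : blk ns -> K :=
  fun t => if tag t == i then y t else x t.

Lemma multilinear_block i (y x : blk ns -> K) :
  F (updb i y x) =
  \sum_(k < ns i) y (coordb k) *: F (updb i (fun t => (t == coordb k)%:R) x).
Proof.
pose comb (s : seq 'I_(ns i)) t := \sum_(k <- s) y (coordb k) * (t == coordb k)%:R.
transitivity (F (updb i (comb (index_enum _)) x)).
  apply: (multilinear_ext i) => t; rewrite /updb /comb; case: eqP => // ti.
  have [k ->] := coordbP ti; rewrite (bigD1 k) //= eqxx mulr1 big1 ?addr0 // => k' ne.
  by rewrite (inj_eq (@coordb_inj i)) eq_sym (negbTE ne) mulr0.
elim: (index_enum _) => [|k s IH].
  rewrite big_nil; set z := updb _ _ _.
  have : F z = 1 *: F z + F z.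
    apply: (@F_multi i) => [//|t ti]; rewrite /z /updb ti eqxx /comb big_nil.
    by rewrite mulr0 addr0.
  by rewrite scale1r => /eqP; rewrite -subr_eq subrr eq_sym => /eqP.
rewrite big_cons -IH; apply: (@F_multi i) => t; rewrite /updb.
  by move/negbTE=> ->.
by move=> ->; rewrite eqxx /comb big_cons.
Qed.

(** Only the blocks in [s] vary, the others being frozen at [y]; the induction releases one block
    and expands it in the standard basis. *)
Lemma polyfun_multilinear (i0 : 'I_d) j : polyfun (fun x => F x 0 j).
Proof.
suff h (s : seq 'I_d) (y : blk ns -> K) :
    polyfun (fun x => F (fun t => if tag t \in s then x t else y t) 0 j).
  apply: polyfun_ext (h (enum 'I_d) (fun=> 0)) => x.
  by apply: (multilinear_entry i0) => t; rewrite mem_enum.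
elim: s y => [|i s IH] y; first exact: (polyfun_const _ (F y 0 j)).
have [ins|nins] := boolP (i \in s).
  apply: polyfun_ext (IH y) => x; apply: (multilinear_entry i0) => t.
  by rewrite inE; case: eqP => [->|]; rewrite ?ins.
apply: (@polyfun_ext _ _ _ (fun x => \sum_(k < ns i) x (coordb k) *
    F (fun t => if tag t \in s then x t else
       updb i (fun t => (t == coordb k)%:R) y t) 0 j)); last first.
  by apply: polyfun_sum => k; apply: polyfunM; [apply: polyfun_coord|apply: IH].
move=> x; transitivity (F (updb i x (fun t => if tag t \in s then x t else y t)) 0 j).
  apply: (multilinear_entry i0) => t.
  by rewrite inE /updb; case: eqP.
rewrite multilinear_block summxE; apply: eq_bigr => k _; rewrite mxE.
congr (_ * _); apply: (multilinear_entry i0) => t; rewrite /updb.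
by case: eqP => [->|//]; rewrite (negbTE nins).
Qed.

Variable l : 'I_d.

Definition wpart (x : blk ns -> K) : wblk ns l -> K := fun s => x (val s).
Definition vpart (x : blk ns -> K) : 'rV[K]_(ns l) := \row_k x (coordb k).

Lemma Fmat_ext (w w' : wblk ns l -> K) : w =1 w' -> Fmat F l w = Fmat F l w'.
Proof.
move=> e; apply/matrixP => k j; rewrite !mxE.
by apply: (multilinear_entry l) => t; rewrite /ext_basis; case: insub.
Qed.

(** With the last block as a row vector v, the equation F = 0 becomes the linear system v A(w) =
    0. *)
Lemma F_Fmat x : F x = vpart x *m Fmat F l (wpart x).
Proof.
transitivity (F (updb l x x)).
  by apply: (multilinear_ext l) => t; rewrite /updb; case: ifP.
rewrite multilinear_block; apply/rowP => j; rewrite summxE !mxE.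
apply: eq_bigr => k _; rewrite !mxE; congr (_ * _).
apply: (multilinear_entry l) => t; rewrite /updb /ext_basis.
case: insubP => [s nl sE|/negPn/eqP tl]; first by rewrite (negbTE nl) -sE.
have [k' ->] := coordbP tl; rewrite /= eqxx (inj_eq (@coordb_inj l)).
by [].
Qed.

Lemma polyfun_Fmat k j : polyfun (fun w => Fmat F l w k j).
Proof.
apply: (@polyfun_ext _ _ _ (fun w => F (ext_basis l w k) 0 j)) => [w|].
  by rewrite mxE.
apply: (polyfun_comp (polyfun_multilinear l j)) => t; rewrite /ext_basis.
by case: insub => [s|]; [apply: polyfun_coord|apply: polyfun_const].
Qed.

Lemma card_blk : #|blk ns| = (#|wblk ns l| + ns l)%N.
Proof.
rewrite card_sig -(cardC [pred t : blk ns | tag t != l]); congr (_ + _)%N.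
transitivity #|codom (@coordb l)|; last by rewrite card_codom ?card_ord //; apply: coordb_inj.
apply: eq_card => t; rewrite !inE negbK; apply/eqP/codomP => [/coordbP //|[k ->] //].
Qed.

(* On the part of W_r where the rows f of the matrix span its row space, the
   coordinates of v outside f are free, and those in f can be adjusted. *)
Lemma trge_WrF_ZF (K_infinite : forall s : seq K, exists x : K, x \notin s) r k :
  trge (WrF F l r) k -> exists2 k', trge (ZF F) k' & (ns l + k <= r + k')%N.
Proof.
case=> c indW; pose A x := Fmat F l (wpart x).
have /algind_union[f indS] : algind (fun w => exists f : {ffun 'I_r -> 'I_(ns l)},
    WrF F l r w /\ (Fmat F l w <= rowsub f (Fmat F l w))%MS) (fun w i => w (c i)).
  by apply: algind_sub indW => w Ww; have [f [g [h _]]] := max_minor Ww; exists f.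
pose S x := WrF F l r (wpart x) /\ (A x <= rowsub f (A x))%MS.
have indS' : algind S (fun x i => x (val (c i))).
  move=> p pS; apply: indS => w [Ww fw].
  pose x : blk ns -> K := fun t => if insub t is Some s then w s else 0.
  have xw : wpart x =1 w by move=> s; rewrite /wpart /x valK.
  rewrite -[RHS](pS x); last by rewrite /S /A /WrF (Fmat_ext xw).
  by apply: meval_eq => i; rewrite -xw.
pose js := [seq coordb k | k <- enum (~: [set f i | i : 'I_r])].
have jsl t : t \in js -> tag t = l by move=> /mapP[j _ ->].
have [||x x' Sx e|c' [ind' c'j]] := algind_free_coords K_infinite (js := js) _ _ _ indS'.
- by rewrite map_inj_uniq ?enum_uniq //; apply: coordb_inj.
- by move=> i; apply/negP => /jsl /eqP; apply/negP/(valP (c i)).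
- have xw : wpart x' =1 wpart x.
    by move=> s; apply: e; apply/negP => /jsl /eqP; apply/negP/(valP s).
  by rewrite /S /A /WrF (Fmat_ext xw).
exists (size js + k)%N; last first.
  rewrite addnA leq_add2r size_map -cardE cardsCs setCK card_ord.
  rewrite -leq_subLR leq_sub2l //.
  by apply: leq_trans (leq_imset_card _ _) _; rewrite card_ord.
exists c' => p pZ; apply: ind' => x [Wx /submxP[u0 fA]].
(* [v0] has its entries in [f] erased. As the rows [f] span, v0 A = (v0 u0) A_f, and subtracting v0
   u0 from the entries in [f] gives a solution [v] that agrees with [x] outside [f]. *)
pose v0 : 'rV[K]_(ns l) :=
  \row_j (if j \in [set f i | i : 'I_r] then 0 else vpart x 0 j).
pose v := v0 - (v0 *m u0) *m rowsub f 1%:M.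
have vA : v *m A x = 0.
  by rewrite mulmxBl -(mulmxA (v0 *m u0)) -rowsubE -mulmxA -fA subrr.
have vE j : j \notin [set f i | i : 'I_r] -> v 0 j = x (coordb j).
  move=> jf; rewrite !mxE (negbTE jf) big1 ?subr0 // => i _; rewrite !mxE.
  case: eqP => [e|]; last by rewrite mulr0.
  by case/negP: jf; rewrite -e imset_f.
pose x' t := if tag t == l then \sum_k v 0 k * (t == coordb k)%:R else x t.
have x'l j : x' (coordb j) = v 0 j.
  rewrite /x' eqxx (bigD1 j) //= eqxx mulr1 big1 ?addr0 // => j' ne.
  by rewrite (inj_eq (@coordb_inj l)) eq_sym (negbTE ne) mulr0.
rewrite -[RHS](pZ x').
  apply: meval_eq => i; case: (c'j i) => [/mapP[j]|[i0 ->]].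
    by rewrite mem_enum inE => jf ->; rewrite x'l vE.
  by rewrite /x'; have /negbTE-> := valP (c i0).
rewrite /ZF F_Fmat -[RHS]vA; congr (_ *m _).
  by apply/rowP => j; rewrite mxE x'l.
by apply: Fmat_ext => s; rewrite /wpart /x'; have /negbTE-> := valP s.
Qed.

(* Where the (f, g) minor is invertible, Cramer's rule expresses the coordinates in
   f, multiplied by the minor, as polynomials in the remaining coordinates. *)
Lemma trge_ZF_WrF k : trge (ZF F) k -> exists r k',
  [/\ (r <= minn (ns l) m)%N, trge (WrF F l r) k' & (k + r <= k' + ns l)%N].
Proof.
case=> c indZ; pose A x := Fmat F l (wpart x).
have /algind_union[r ind1] : algind (fun x => exists r : 'I_(minn (ns l) m).+1,
    ZF F x /\ \rank (A x) = r) (fun x i => x (c i)).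
  apply: algind_sub indZ => x Zx.
  have lt : (\rank (A x) < (minn (ns l) m).+1)%N.
    by rewrite ltnS leq_min rank_leq_row rank_leq_col.
  by exists (Ordinal lt).
have /algind_union[[f g] ind] : algind (fun x =>
    exists fg : {ffun 'I_r -> 'I_(ns l)} * {ffun 'I_r -> 'I_m},
    [/\ ZF F x, \rank (A x) = r & \det (mxsub fg.1 fg.2 (A x)) != 0])
    (fun x i => x (c i)).
  apply: algind_sub ind1 => x [Zx rx]; have [f [g [_ h]]] := max_minor rx.
  by exists (f, g).
move: ind => /=; set S := (fun x => [/\ _, _ & _]) => ind.
have finj : injective f.
  have [x [_ _ det0]] := algind_nonempty ind.
  move=> i i' e; apply/eqP; apply: contraNT det0 => ne; apply/eqP.
  by apply: (determinant_alternate ne) => j; rewrite !mxE e.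
(* [J] holds the coordinates to be eliminated; they lie in the last block, so the matrix does not
   depend on them. *)
pose J := [set coordb (f i) | i : 'I_r].
pose T' : finType := {t : blk ns | t \notin J}.
pose res (x : blk ns -> K) : T' -> K := fun s => x (val s).
have wJ (s : wblk ns l) : val s \notin J.
  by apply/negP => /imsetP[i _ e]; have := valP s; rewrite e eqxx.
pose wres (z : T' -> K) : wblk ns l -> K := fun s => z (Sub (val s) (wJ s)).
pose A' z := Fmat F l (wres z).
have A'E x : A' (res x) = A x by apply: Fmat_ext => s; rewrite /wres /res SubK.
have polyA' i j : polyfun (fun z => A' z i j).
  by apply: (polyfun_comp (polyfun_Fmat i j)) => s; apply: polyfun_coord.
pose v0 (z : T' -> K) : 'rV[K]_(ns l) :=
  \row_j (if insub (coordb j) is Some s then z s else 0).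
have polyB i j : polyfun (fun z => mxsub f g (A' z) i j).
  by apply: polyfun_ext (polyA' (f i) (g j)) => z; rewrite mxE.
(* With B the minor, the columns [g] of the system read v0 A_g + vJ B = 0; multiplying by the
   adjugate of B isolates det(B) vJ. *)
have cramer x : S x -> \det (mxsub f g (A x)) *: (\row_i x (coordb (f i))) =
    - (v0 (res x) *m colsub g (A x) *m \adj (mxsub f g (A x))).
  move=> [Zx _ _]; set vJ := \row_i _.
  have vE : vpart x = v0 (res x) + vJ *m rowsub f 1%:M.
    apply/rowP => j; rewrite !mxE; case: insubP => [s sJ sE|/negPn jJ].
      rewrite /res sE big1 ?addr0 // => i _; rewrite !mxE.
      case: eqP => [e|]; last by rewrite mulr0.
      by case/negP: sJ; rewrite -e; apply/imsetP; exists i.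
    have /imsetP[i _ /coordb_inj ->] := jJ.
    rewrite add0r (bigD1 i) //= !mxE eqxx mulr1 big1 ?addr0 // => i' ne.
    by rewrite !mxE (inj_eq finj) (negbTE ne) mulr0.
  have := congr1 (colsub g) (F_Fmat x); rewrite (_ : F x = 0) //.
  rewrite vE mulmxDl -mulmxA -rowsubE -/(A x).
  move=> e; have {}e : v0 (res x) *m colsub g (A x) + vJ *m mxsub f g (A x) = 0.
    have -> : mxsub f g (A x) = colsub g (rowsub f (A x)).
      by apply/matrixP => i j; rewrite !mxE.
    by apply/rowP => j; move/rowP/(_ j): e; rewrite !mulmx_colsub !mxE.
  move/eqP: e; rewrite addrC addr_eq0 => /eqP e.
  by rewrite -mulNmx -e -mulmxA mul_mx_adj mul_mx_scalar.
have [D HD] : polyfun (fun z => \det (mxsub f g (A' z))) by apply: polyfun_det.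
have /fin_all_exists[P HP] (i : 'I_k) : exists P : {mpoly K[#|T'|]},
    forall x, S x -> D.@[evT (res x)] * x (c i) = P.@[evT (res x)].
  have [/imsetP[i0 _ ci]|nJ] := boolP (c i \in J); last first.
    exists (D * 'X_(enum_rank (Sub (c i) nJ : T'))) => x _.
    by rewrite mevalM mevalXU /evT enum_rankK /res SubK.
  have [Q HQ] : polyfun (fun z => - (v0 z *m colsub g (A' z) *m
      \adj (mxsub f g (A' z))) 0 i0).
    apply: (@polyfun_ext _ _ _ (fun z => (-1) * (v0 z *m colsub g (A' z) *m
      \adj (mxsub f g (A' z))) 0 i0)) => [z|]; first by rewrite mulN1r.
    apply: polyfunM; first exact: polyfun_const.
    apply: (polyfun_mulmx (M := fun z => v0 z *m colsub g (A' z))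
      (N := fun z => \adj (mxsub f g (A' z)))) => [a b|a b]; last exact: polyfun_adj.
    apply: (polyfun_mulmx (M := v0) (N := fun z => colsub g (A' z))) => i' j'.
      apply: (@polyfun_ext _ _ _ (fun z => if insub (coordb j') is Some s then z s else 0)).
        by move=> z; rewrite mxE.
      by case: insub => [s|]; [apply: polyfun_coord|apply: polyfun_const].
    by apply: polyfun_ext (polyA' i' (g j')) => z; rewrite mxE.
  exists Q => x Sx; rewrite -HQ -HD A'E ci.
  by have /rowP/(_ i0) := cramer x Sx; rewrite !mxE.
(* All chosen coordinates are rational in those outside [J] with denominator the minor, so [k]
   coordinates outside [J] are independent. *)
have [x Sx|c' ind'] := algind_transfer (x := fun x => evT (res x)) (D := D) _
  (fun x i => HP i x) ind.
  by rewrite -HD A'E; case: Sx.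
pose e i : blk ns := val (enum_val (c' i)).
have einj : injective e.
  move=> i i' /val_inj /enum_val_inj.
  exact: (algind_inj (x := fun x => evT (res x)) ind').
have {}ind' : algind S (fun x i => x (e i)) by exact: ind'.
(* Those in the last block avoid [J], so they number at most n_l - r; the remaining ones, indexed by
   [A1], are independent on W_r. *)
pose A1 := [set i | tag (e i) != l].
have cA2 : (#|~: A1| + r <= ns l)%N.
  have sub : e @: (~: A1) \subset (@coordb l) @: (~: [set f i | i : 'I_r]).
    apply/subsetP => _ /imsetP[i iA2 ->]; move: iA2; rewrite !inE negbK => /eqP.
    move=> /coordbP[j ej]; rewrite ej imset_f // inE; apply/negP => /imsetP[i' _ ji'].
    have /negP := valP (enum_val (c' i)); apply; apply/imsetP; exists i' => //.
    by rewrite -ji' -ej.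
  have := subset_leq_card sub; rewrite !card_imset //; last exact: coordb_inj.
  rewrite [X in (_ <= X)%N]cardsCs setCK card_ord card_imset // card_ord.
  by rewrite addnC leq_subRL //; have := ltn_ord r; rewrite ltnS leq_min => /andP[].
exists (r : nat), #|A1|; split; first by rewrite -ltnS.
- have A1P (j : 'I_#|A1|) : tag (e (enum_val j)) != l by have := enum_valP j; rewrite inE.
  exists (fun j => Sub (e (enum_val j)) (A1P j)) => p pW.
  apply: (algind_subfamily (@enum_val_inj _ (mem A1)) ind') => x [_ rx _].
  by rewrite -[RHS](pW (wpart x) rx); apply: meval_eq => j; rewrite /wpart SubK.
by rewrite -[k in (k + _)%N]card_ord -(cardsC A1) -addnA leq_add2l.
Qed.

End Multilinear.

(** * The codimension formula *)

Theorem theorem1p1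
  (K : fieldType)
  (K_infinite : forall s : seq K, exists x : K, x \notin s)
  (L : closedFieldType) (iota : {rmorphism K -> L})
  (L_algebraic : forall y : L, exists p : {poly K},
      p != 0 /\ root (map_poly iota p) y)
  (d : nat) (hd : (2 <= d)%N) (ns : 'I_d -> nat)
  (ns_pos : forall i, (0 < ns i)%N) (m : nat) (m_pos : (0 < m)%N)
  (F : (blk ns -> K) -> 'rV[K]_m) (F_multi : multilinear F) :
  let l := lastd (ltnW hd) in
  zcodim (zclosure iota (ZF F)) =
  \big[omin/None]_(r < (minn (ns l) m).+1)
     oadd (Some (r : nat)) (zcodim (zclosure iota (WrF F l r))).
Proof.
move=> l; apply: ole_ext => e; rewrite ole_bigomin.
have leP (T : finType) (S : (T -> K) -> Prop) a :
    ole (zcodim (zclosure iota S)) a <-> exists2 k, trge S k & (#|T| <= k + a)%N.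
  rewrite zcodim_le; last exact: zclosure_closed.
  by split=> -[k /trge_zclosure tk le]; exists k.
have oaddP r o : ole (oadd (Some r) o) e = (r <= e)%N && ole o (e - r).
  case: o => [a|] /=; last by rewrite andbF.
  by lia.
apply/idP/existsP => [/leP[k tk]|[r]].
  have [r [k' [rmin tW le]]] := trge_ZF_WrF F_multi l tk.
  rewrite (card_blk ns l) => cle.
  (* This bound forces [r <= e], so that the difference [e - r] is not truncated. *)
  have lek := trge_le_card tW.
  have re : (r <= e)%N by move: cle le lek; lia.
  exists (inord r); rewrite oaddP inordK // re /=; apply/leP; exists k' => //.
  by move: cle le; lia.
rewrite oaddP => /andP[re /leP[k tW le]]; apply/leP.
have [k' tZ le'] := trge_WrF_ZF F_multi K_infinite tW.
by exists k' => //; rewrite (card_blk ns l); move: le le' re; lia.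
Qed.
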